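(* Let $\Omega$ be a Polish space and let $\mathscr{T}=(T(t))_{t\ge 0}$ be a stochastically continuous Markovian semigroup on $\mathscr{M}(\Omega)$. If $\mathscr{T}$ is $B_b$-ergodic and $T(t_0)$ is strong Feller for some $t_0>0$, then $\lim_{t\to\infty} T(t)\mu$ exists (in the total variation norm) for all $\mu\in\mathscr{M}(\Omega)$.
   Context: $\Omega$ is a Polish space with Borel $\sigma$-algebra $\mathscr{B}(\Omega)$. $\mathscr{M}(\Omega)$ is the Banach lattice of (finite) signed measures on $\mathscr{B}(\Omega)$ with the total variation norm, $B_b(\Omega)$ the space of bounded Borel-measurable real functions and $C_b(\Omega)$ the space of bounded continuous real functions on $\Omega$; $\langle\cdot,\cdot\rangle$ denotes the duality $\langle\mu,f\rangle=\int_\Omega f\,\mathrm{d}\mu$ between $\mathscr{M}(\Omega)$ and $B_b(\Omega)$. $\mathscr{L}(\mathscr{M}(\Omega))$ denotes the bounded linear operators on $\mathscr{M}(\Omega)$. A Markovian transition kernel is a map $k:\Omega\times\mathscr{B}(\Omega)\to[0,\infty)$ such that $k(x,\cdot)$ is a probability measure for every $x\in\Omega$ and $k(\cdot,A)$ is measurable for every $A\in\mathscr{B}(\Omega)$. An operator $T\in\mathscr{L}(\mathscr{M}(\Omega))$ is Markovian if there is a Markovian transition kernel $k$ with $(T\mu)(A)=\int_\Omega k(x,A)\,\mathrm{d}\mu(x)$ for all $\mu\in\mathscr{M}(\Omega)$, $A\in\mathscr{B}(\Omega)$. In this case $T'$ denotes the restriction to $B_b(\Omega)$ of the norm adjoint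 $T^*$, i.e. $(T'f)(x)=\int_\Omega f(y)\,k(x,\mathrm{d}y)$. A Markovian operator $T$ is strong Feller if $T'f\in C_b(\Omega)$ for all $f\in B_b(\Omega)$. A Markovian semigroup on $\mathscr{M}(\Omega)$ is a family $(T(t))_{t\ge0}$ of Markovian operators with $T(t+s)=T(t)T(s)$ for all $t,s\ge0$ and $T(0)=I$. It is stochastically continuous if $t\mapsto\langle T(t)\mu,f\rangle$ is continuous on $[0,\infty)$ for all $f\in C_b(\Omega)$ and $\mu\in\mathscr{M}(\Omega)$. For such a semigroup and $t>0$, $A_t\in\mathscr{L}(\mathscr{M}(\Omega))$ denotes the Markovian operator satisfying $\langle A_t\mu,f\rangle=\frac1t\int_0^t\langle T(s)\mu,f\rangle\,\mathrm{d}s$ for all $\mu\in\mathscr{M}(\Omega)$, $f\in B_b(\Omega)$. The semigroup is $B_b$-ergodic if $\lim_{t\to\infty}A_t\mu$ exists in the $\sigma(\mathscr{M}(\Omega),B_b(\Omega))$-topology for all $\mu\in\mathscr{M}(\Omega)$. *)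

(* Defs.v *)
From HB Require Import structures.
From mathcomp Require Import all_boot all_order all_algebra.
From mathcomp Require Import all_classical all_reals all_analysis.

Set Implicit Arguments.
Unset Strict Implicit.
Unset Printing Implicit Defensive.

Import Order.TTheory GRing.Theory Num.Theory.
Import numFieldNormedType.Exports.

Local Open Scope classical_set_scope.
Local Open Scope ring_scope.

Definition is_metric (R : realType) (X : Type) (d : X -> X -> R) : Prop :=
  [/\ forall x y, 0 <= d x y,
      forall x y, d x y = 0 <-> x = y,
      forall x y, d x y = d y x &
      forall x y z, d x z <= d x y + d y z].

Definition metric_induces (R : realType) (X : topologicalType)
    (d : X -> X -> R) : Prop :=
  forall (x : X) (U : set X),
    nbhs x U <-> exists2 e : R, 0 < e & [set y | d x y < e] `<=` U.

Definition metric_complete (R : realType) (X : topologicalType)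
    (d : X -> X -> R) : Prop :=
  forall u : nat -> X,
    (forall e : R, 0 < e -> exists N : nat, forall m n : nat,
       (N <= m)%N -> (N <= n)%N -> d (u m) (u n) < e) ->
    exists x : X, u n @[n --> \oo] --> x.

Definition polish (R : realType) (X : topologicalType) : Prop :=
  (exists2 D : set X, countable D & dense D) /\
  (exists d : X -> X -> R,
     [/\ is_metric d, metric_induces d & metric_complete d]).

Notation borel X := (g_sigma_algebraType (@open X)).

(* A charge also takes (arbitrary) values on non-Borel sets, so equality in the
   space of signed measures is [charge_eq] rather than Leibniz equality. *)
Notation signed_measure R X := (charge (borel X) R).

Definition charge_eq (R : realType) (X : ptopologicalType)
    (mu nu : signed_measure R X) : Prop :=
  forall A : set (borel X), measurable A -> mu A = nu A.

Definition hahn_pos (R : realType) (X : ptopologicalType)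
    (mu : signed_measure R X) : set (borel X) :=
  sval (cid (Hahn_decomposition mu)).

Definition hahn_neg (R : realType) (X : ptopologicalType)
    (mu : signed_measure R X) : set (borel X) :=
  sval (cid (svalP (cid (Hahn_decomposition mu)))).

Lemma hahn_pos_neg (R : realType) (X : ptopologicalType)
    (mu : signed_measure R X) :
  hahn_decomposition mu (hahn_pos mu) (hahn_neg mu).
Proof. exact: (svalP (cid (svalP (cid (Hahn_decomposition mu))))). Qed.

(* Integration against a signed measure, through its Jordan decomposition. *)
Definition pairing (R : realType) (X : ptopologicalType)
    (mu : signed_measure R X) (f : X -> R) : R :=
  \int[jordan_pos (hahn_pos_neg mu)]_x f x
  - \int[jordan_neg (hahn_pos_neg mu)]_x f x.

Definition tv_norm (R : realType) (X : ptopologicalType)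
    (mu : signed_measure R X) : R :=
  fine (charge_variation (hahn_pos_neg mu) [set: borel X]).

Definition B_b (R : realType) (X : ptopologicalType) : set (X -> R) :=
  [set f | measurable_fun [set: borel X] (f : borel X -> R) /\ bounded_fun f].

Definition C_b (R : realType) (X : ptopologicalType) : set (X -> R) :=
  [set f | continuous f /\ bounded_fun f].

Definition operator (R : realType) (X : ptopologicalType) : Type :=
  signed_measure R X -> signed_measure R X.

Definition bounded_linear (R : realType) (X : ptopologicalType)
    (S : operator R X) : Prop :=
  (forall (a : R) (mu nu : signed_measure R X),
     charge_eq (S (cadd (cscale a mu) nu)) (cadd (cscale a (S mu)) (S nu))) /\
  (exists C : R, forall mu : signed_measure R X,
     tv_norm (S mu) <= C * tv_norm mu).

Definition transition_kernel (R : realType) (X : ptopologicalType) : Type :=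
  R.-pker (borel X) ~> (borel X).

Definition has_kernel (R : realType) (X : ptopologicalType)
    (S : operator R X) (k : transition_kernel R X) : Prop :=
  forall (mu : signed_measure R X) (A : set (borel X)), measurable A ->
    S mu A = (pairing mu (fun x => fine (k x A)))%:E.

Definition markovian (R : realType) (X : ptopologicalType)
    (S : operator R X) : Prop :=
  bounded_linear S /\ exists k : transition_kernel R X, has_kernel S k.

Definition kernel_adjoint (R : realType) (X : ptopologicalType)
    (k : transition_kernel R X) (f : X -> R) : X -> R :=
  fun x => \int[k x]_y f y.

(* The kernel of a Markovian operator is unique on Borel sets, so the choice of
   [k] is immaterial. *)
Definition strong_feller (R : realType) (X : ptopologicalType)
    (S : operator R X) : Prop :=
  bounded_linear S /\
  exists2 k : transition_kernel R X, has_kernel S k &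
    forall f : X -> R, B_b f -> C_b (kernel_adjoint k f).

(* Only the values at nonnegative times are constrained. *)
Definition markovian_semigroup (R : realType) (X : ptopologicalType)
    (T : R -> operator R X) : Prop :=
  [/\ forall t : R, 0 <= t -> markovian (T t),
      forall t s : R, 0 <= t -> 0 <= s -> forall mu : signed_measure R X,
        charge_eq (T (t + s) mu) (T t (T s mu)) &
      forall mu : signed_measure R X, charge_eq (T 0 mu) mu].

Definition stochastically_continuous (R : realType) (X : ptopologicalType)
    (T : R -> operator R X) : Prop :=
  forall (f : X -> R) (mu : signed_measure R X), C_b f ->
    {within `[0, +oo[, continuous (fun t : R => pairing (T t mu) f)}.

Definition is_average (R : realType) (X : ptopologicalType)
    (T : R -> operator R X) (t : R) (S : operator R X) : Prop :=
  markovian S /\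
  forall (mu : signed_measure R X) (f : X -> R), B_b f ->
    pairing (S mu) f =
    t^-1 * \int[@lebesgue_measure R]_(s in `[0, t]) pairing (T s mu) f.

(* [A t] exists for every stochastically continuous Markovian semigroup and is
   unique up to [charge_eq]; convergence in sigma(M, B_b) is convergence of the
   pairings with all elements of [B_b]. *)
Definition B_b_ergodic (R : realType) (X : ptopologicalType)
    (T : R -> operator R X) : Prop :=
  exists A : R -> operator R X,
    (forall t : R, 0 < t -> is_average T t (A t)) /\
    forall mu : signed_measure R X, exists nu : signed_measure R X, forall f : X -> R, B_b f ->
      pairing (A t mu) f @[t --> +oo] --> pairing nu f.

Definition tv_cvg (R : realType) (X : ptopologicalType)
    (F : R -> signed_measure R X) (nu : signed_measure R X) : Prop :=
  tv_norm (cadd (F t) (copp nu)) @[t --> +oo] --> (0 : R).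

(* Main.v *)
(** A strong Feller operator Q = T(t0)' charges, from every point, only sets seen
    by one finite measure La. Hence Q is, up to a small mass, uniformly
    approximated by finite-rank operators, and turns setwise convergence of
    positive measures into convergence in total variation.

    Let V(S) = lim_n ||T(n) S|| and osc_s(x) = V(delta_x - T(s) delta_x).
    Stochastic continuity and the previous remark give osc_s(x) -> 0 as s -> 0.
    The set {osc_(s/2^n) <= 1} is absorbing up to null sets of pi, the invariant
    limit of the averages, and a zero-two law holds on it: for h = s/2^n and
    v_j = sup V(L - T(jh) L) over L << pi living there of mass at most 1, the
    estimate v_1 <= 1 provides a common part of T(r) L and T(r+h) L, hence
    2 v_(j+1) <= v_j + v_(j+2), and the bounded sequence v with v_0 = 0
    vanishes. Letting n grow, this yields
    V(L - T(s) L) = 0 for all s and all L << pi; the mass of T(r) L outside the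
    absolutely continuous part is small for suitable r, by ergodicity, so this
    holds for every L. Averaging over s, and using A_t L -> pi, it follows that
    V(L - pi) = 0. *)

Require Import Defs.
From HB Require Import structures.
From mathcomp Require Import all_boot all_order all_algebra.
From mathcomp Require Import all_classical all_reals all_analysis.
From mathcomp Require Import measurable_realfun ring lra.

Set Implicit Arguments.
Unset Strict Implicit.
Unset Printing Implicit Defensive.

Import Order.TTheory GRing.Theory Num.Theory.
Import numFieldNormedType.Exports.

Local Open Scope classical_set_scope.
Local Open Scope ring_scope.

(** * Finite measures as functionals *)

Section Functionals.
Context d (Y : measurableType d) (R : realType).
Implicit Types (f g : Y -> R) (S L : (Y -> R) -> R) (B N : set Y).

(** Two obstacles shape the argument. Nothing is irreducible and invariant measures may be many, so
    pi is attached to the starting measure L, and absolute continuity is always relative to that pi.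
    And stochastic continuity tests continuous functions only, so orbits are known to be continuous
    only after one factor [Q t0]; each passage from there to the norm spends a second factor. This
    is why the limit appears as T(t0) applied to the limit of the averages. The threshold 1 in osc
    <= 1 is half the trivial bound 2 on the norm of a difference of two probabilities: it leaves
    room to reach norm at most 3/2 at a finite time, and 3/2 means a common part of a quarter of the
    mass. Small steps make {osc <= 1} nearly everything, and dyadic ones have s itself as a
    multiple. Measures are kept as functionals on bounded measurable functions, so that
    restrictions, images under [Q t] and limits are plain formulas in the test function. *)

Definition bm f : Prop :=
  measurable_fun setT f /\ exists M : R, forall x, `|f x| <= M.

Definition bm1 f : Prop := measurable_fun setT f /\ forall x, `|f x| <= 1.

Definition bcvg (F : nat -> Y -> R) f : Prop :=
  [/\ forall n, measurable_fun setT (F n),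
      exists M : R, forall n x, `|F n x| <= M &
      forall x, F n x @[n --> \oo] --> f x].

Lemma bm1_bm f : bm1 f -> bm f.
Proof. by case=> mf f1; split => //; exists 1. Qed.

Lemma bm_cst (a : R) : bm (fun=> a).
Proof. by split; [exact: measurable_cst | exists `|a|]. Qed.

Lemma bmD f g : bm f -> bm g -> bm (fun x => f x + g x).
Proof.
move=> [mf [M Mf]] [mg [M' Mg]]; split; first exact: measurable_funD.
by exists (M + M') => x; rewrite (le_trans (ler_normD _ _))// lerD.
Qed.

Lemma bmM f g : bm f -> bm g -> bm (fun x => f x * g x).
Proof.
move=> [mf [M Mf]] [mg [M' Mg]]; split; first exact: measurable_funM.
by exists (M * M') => x; rewrite normrM ler_pM.
Qed.

Lemma bmZ (a : R) f : bm f -> bm (fun x => a * f x).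
Proof. exact/bmM/bm_cst. Qed.

Lemma bmN f : bm f -> bm (fun x => - f x).
Proof.
by move=> /(bmZ (-1)); congr bm; apply/funext => x; rewrite mulN1r.
Qed.

Lemma bmB f g : bm f -> bm g -> bm (fun x => f x - g x).
Proof. by move=> bf /bmN; exact: bmD. Qed.

Lemma bm_abs f : bm f -> bm (fun x => `|f x|).
Proof.
move=> [mf [M Mf]]; split; first exact: measurableT_comp.
by exists M => x; rewrite normr_id.
Qed.

Lemma bm_sum (I : Type) (r : seq I) (F : I -> Y -> R) :
  (forall i, bm (F i)) -> bm (fun x => \sum_(i <- r) F i x).
Proof.
move=> bF; elim: r => [|i r IH].
  by move: (bm_cst 0); congr bm; apply/funext => x; rewrite big_nil.
move: (bmD (bF i) IH); congr bm; apply/funext => x; by rewrite big_cons.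
Qed.

Lemma bm_indic B : measurable B -> bm \1_B.
Proof.
move=> mB; split; first exact: measurable_indic.
by exists 1 => x; rewrite indicE; case: (_ \in _); rewrite ?normr1 ?normr0.
Qed.

Lemma bm_cvg F f : bcvg F f -> bm f.
Proof.
move=> [mF [M FM] Ff]; split.
  by apply: (@measurable_fun_cvg _ _ _ setT F) => // x _; exact: Ff.
exists M => x; have c : `|F n x| @[n --> \oo] --> `|f x| by exact: cvg_norm.
rewrite -(cvg_lim _ c)//.
by apply: limr_le; [exact: cvgP c|exact: nearW].
Qed.

Lemma indic_01 B x : 0 <= (\1_B x : R) <= 1.
Proof. by rewrite indicE; case: (_ \in _); rewrite /= ?ler01 ?lexx. Qed.

Lemma indic_setC B x : (\1_(~` B) x : R) = 1 - \1_B x.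
Proof.
rewrite !indicE in_setC; case: (_ \in _); rewrite /= ?subrr ?subr0 //.
Qed.

Lemma indic_setI (A B : set Y) x : \1_(A `&` B) x = \1_A x * \1_B x :> R.
Proof. by rewrite indicI. Qed.

Lemma indic_sqr (A : set Y) x : \1_A x * \1_A x = \1_A x :> R.
Proof. by rewrite -indic_setI setIid. Qed.

Lemma indic_ge0 (A : set Y) x : 0 <= \1_A x :> R.
Proof. by have /andP[] := indic_01 A x. Qed.

Lemma indic_le1 (A : set Y) x : \1_A x <= 1 :> R.
Proof. by have /andP[] := indic_01 A x. Qed.

Lemma bcvg_indic_bigcup (F : nat -> set Y) : (forall k, measurable (F k)) ->
  bcvg (fun k => \1_(\big[setU/set0]_(i < k) F i)) \1_(\bigcup_k F k).
Proof.
move=> mF; split.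
- by move=> k; apply: measurable_indic; exact: bigsetU_measurable.
- by exists 1 => k x; rewrite ger0_norm ?indic_le1 ?indic_ge0.
- move=> x; apply: (@cvg_near_cst _ _ _ _ _).
  have [[i _ Fix]|nF] := pselect ((\bigcup_i F i) x).
    exists i.+1 => // k /= ik; rewrite !indicE !mem_set//; first by exists i.
    by rewrite -bigcup_mkord; exists i.
  apply: nearW => k; rewrite !indicE !memNset//.
  by rewrite -bigcup_mkord => -[i _ Fix]; apply: nF; exists i.
Qed.

(** The sum counts the integers in [1, y], which is the integer part of y; the induction on [K]
    removes the first term and lowers y by 1. *)
Lemma sum_floor (y : R) (K : nat) : 0 <= y -> y <= K%:R ->
  y - 1 <= \sum_(k < K) (k.+1%:R <= y)%R%:R <= y.
Proof.
elim: K y => [|K IH] y y0 yK.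
  by rewrite big_ord0; lra.
rewrite big_ord_recl /=.
have [y1|y1] := leP 1 y.
  have {IH} := IH (y - 1); rewrite subr_ge0 lerBlDr natr1 => /(_ y1 yK).
  rewrite (eq_bigr (fun k : 'I_K => (k.+2%:R <= y)%R%:R)); last first.
    by move=> k _; rewrite lerBrDr natr1.
  rewrite /bump/= => /andP[? ?]; lra.
rewrite add0r big1 => [|i _]; first lra.
case: leP => // h; have : 1%:R <= (bump 0 i).+1%:R :> R by rewrite ler_nat.
by move=> h1; move: (le_trans h1 h); rewrite leNgt y1.
Qed.

(** For 0 <= f <= M this is the integer part of (n+1) f divided by n+1, written through superlevel
    sets so that only indicators with nonnegative coefficients occur. *)
Definition layers f (M n : nat) (x : Y) : R :=
  n.+1%:R^-1 * \sum_(k < M * n.+1) \1_[set y | k.+1%:R <= n.+1%:R * f y] x.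

Lemma layers_bound f M n x : 0 <= f x -> f x <= M%:R ->
  f x - n.+1%:R^-1 <= layers f M n x <= f x.
Proof.
move=> f0 fM; rewrite /layers.
have n0 : 0 < n.+1%:R :> R by rewrite ltr0n.
have /andP[h1 h2]: n.+1%:R * f x - 1 <= \sum_(k < M * n.+1)
    \1_[set y | k.+1%:R <= n.+1%:R * f y] x <= n.+1%:R * f x.
  under eq_bigr => k _ do rewrite indicE mem_setE/=.
  apply: sum_floor; first by rewrite mulr_ge0// ltW.
  by rewrite natrM mulrC ler_wpM2r// ltW.
rewrite -[X in X - _](mulKf (lt0r_neq0 n0)) -[X in _ - X]mulr1 -mulrBr.
rewrite ler_pM2l ?invr_gt0// h1/= mulrC ler_pdivrMr//.
by rewrite mulrC.
Qed.

Lemma measurable_level f (a b : R) : measurable_fun setT f ->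
  measurable [set y | a <= b * f y].
Proof.
move=> mf; rewrite -[X in measurable X]setTI.
by apply: measurable_fun_le => //; exact: measurable_funM.
Qed.

Lemma bcvg_layers f M : measurable_fun setT f ->
  (forall x, 0 <= f x <= M%:R) -> bcvg (layers f M) f.
Proof.
move=> mf fM; split.
- move=> n; apply: measurable_funM; first exact: measurable_cst.
  apply: measurable_sum => k; apply: measurable_indic.
  exact: measurable_level.
- exists (M%:R + 1) => n x; have /andP[f0 f1] := fM x.
  have /andP[h1 h2] := layers_bound n f0 f1.
  have : n.+1%:R^-1 <= 1 :> R by rewrite invf_le1 ?ltr0n// ler1n.
  by move: h1; set c := n.+1%:R^-1 => h1 h3; rewrite ler_norml; apply/andP; split; lra.
- move=> x; have /andP[f0 f1] := fM x.
  apply: (@squeeze_cvgr _ _ _ _ (fun n => f x - n.+1%:R^-1) (fun=> f x)).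
  + by apply: nearW => n; exact: layers_bound.
  + by rewrite -[X in _ --> X]subr0; apply: cvgB; [exact: cvg_cst|exact: cvg_harmonic].
  + exact: cvg_cst.
Qed.

(** The coefficients of [layers] are nonnegative, so the linear clause may ask for 0 <= a; this lets
    sign conditions be propagated, as in [signed_ge0]. *)
Lemma bm_ind_ge0 (P : (Y -> R) -> Prop) :
  (forall B, measurable B -> P \1_B) ->
  (forall a f g, 0 <= a -> bm f -> bm g -> P f -> P g ->
     P (fun x => a * f x + g x)) ->
  (forall F f, bcvg F f -> (forall n, P (F n)) -> P f) ->
  forall f, bm f -> (forall x, 0 <= f x) -> P f.
Proof.
move=> P1 PD Pc f [mf [M0 M0f]] f0.
have [M Mf] : exists M : nat, forall x, f x <= M%:R.
  exists (Num.trunc `|M0|).+1 => x.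
  rewrite (le_trans (ler_norm _))// (le_trans (M0f x))// (le_trans (ler_norm _))//.
  by rewrite ltW// truncnS_gt.
apply: (Pc (layers f M)).
  by apply: bcvg_layers => // x; rewrite f0 Mf.
have P0 : P (fun=> 0).
  by move: (P1 set0 measurable0); congr P; apply/funext => x; rewrite indic0.
move=> n; rewrite /layers; elim: (M * n.+1)%N => [|K IH].
  by move: P0; congr P; apply/funext => x; rewrite big_ord0 mulr0.
have n0 : 0 <= n.+1%:R^-1 :> R by [].
have mK k := measurable_level k.+1%:R n.+1%:R mf.
have := PD _ _ _ n0 (bm_indic (mK K)) _ (P1 _ (mK K)) IH.
have bmS : bm (fun x => n.+1%:R^-1 *
    \sum_(k < K) \1_[set y | k.+1%:R <= n.+1%:R * f y] x).
  apply: bmZ; apply: bm_sum => k; exact/bm_indic/mK.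
move=> /(_ bmS); congr P; apply/funext => x.
by rewrite big_ord_recr/= mulrDr addrC.
Qed.

(** A bounded f becomes nonnegative after adding a bound M, and M is a multiple of the indicator of
    the whole space. *)
Lemma bm_ind (P : (Y -> R) -> Prop) :
  (forall B, measurable B -> P \1_B) ->
  (forall a f g, bm f -> bm g -> P f -> P g -> P (fun x => a * f x + g x)) ->
  (forall F f, bcvg F f -> (forall n, P (F n)) -> P f) ->
  forall f, bm f -> P f.
Proof.
move=> P1 PD Pc f bf.
have [M Mf] := bf.2.
have bg : bm (fun x => f x + M) by apply: bmD => //; exact: bm_cst.
have Pg : P (fun x => f x + M).
  apply: bm_ind_ge0 => //.
    by move=> a h k _; exact: PD.
  by move=> x; have := Mf x; rewrite ler_norml; lra.
have := PD (- M) _ _ (bm_indic measurableT) bg (P1 _ measurableT) Pg.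
by congr P; apply/funext => x; rewrite indicT mulr1 addrC addrK.
Qed.

(* Finite signed measures are represented by their integrals; sigma-additivity
   is continuity under bounded pointwise convergence. *)
Record signed S : Prop := Signed {
  sg_lin : forall a f g, bm f -> bm g ->
    S (fun x => a * f x + g x) = a * S f + S g ;
  sg_cts : forall F f, bcvg F f -> S (F n) @[n --> \oo] --> S f }.

Definition pos L : Prop :=
  signed L /\ forall f, bm f -> (forall x, 0 <= f x) -> 0 <= L f.

Section signed_theory.
Variables (S : (Y -> R) -> R) (sS : signed S).

Lemma sg0 : S (fun=> 0) = 0.
Proof.
have := sg_lin sS 1 (bm_cst 0) (bm_cst 0).
rewrite mul1r (_ : (fun _ => _) = (fun=> 0)).
  by move/eqP; rewrite mul1r -[X in X == _]addr0 (inj_eq (addrI _)) => /eqP.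
by apply/funext => x; rewrite addr0.
Qed.

Lemma sgZ a f : bm f -> S (fun x => a * f x) = a * S f.
Proof.
move=> bf; have := sg_lin sS a bf (bm_cst 0); rewrite sg0 addr0 => <-.
by congr S; apply/funext => x; rewrite addr0.
Qed.

Lemma sgD f g : bm f -> bm g -> S (fun x => f x + g x) = S f + S g.
Proof.
move=> bf bg; rewrite -[X in X + _]mul1r -(sg_lin sS)//.
by congr S; apply/funext => x; rewrite mul1r.
Qed.

Lemma sgN f : bm f -> S (fun x => - f x) = - S f.
Proof.
move=> bf; rewrite -mulN1r -sgZ//.
by congr S; apply/funext => x; rewrite mulN1r.
Qed.

Lemma sgB f g : bm f -> bm g -> S (fun x => f x - g x) = S f - S g.
Proof. by move=> bf bg; rewrite sgD ?sgN//; exact: bmN. Qed.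

Lemma sg_sum (I : Type) (r : seq I) (F : I -> Y -> R) :
  (forall i, bm (F i)) ->
  S (fun x => \sum_(i <- r) F i x) = \sum_(i <- r) S (F i).
Proof.
move=> bF; elim: r => [|i r IH].
  by rewrite big_nil -[RHS]sg0; congr S; apply/funext => x; rewrite big_nil.
rewrite big_cons -IH -sgD//; last exact: bm_sum.
by congr S; apply/funext => x; rewrite big_cons.
Qed.

Lemma signed_restr k : bm k -> signed (fun f => S (fun x => k x * f x)).
Proof.
move=> bk; split.
  move=> a f g bf bg; rewrite -(sg_lin sS); [|exact: bmM..].
  by congr S; apply/funext => x; ring.
move=> F f [mF [M FM] Ff]; apply: (sg_cts sS); split.
- by move=> n; apply: measurable_funM => //; case: bk.
- case: bk => mk [K kK]; exists (K * M) => n x.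
  by rewrite normrM ler_pM.
- by move=> x; apply: cvgM => //; exact: cvg_cst.
Qed.

End signed_theory.

Lemma signed_lin (a : R) S1 S2 : signed S1 -> signed S2 ->
  signed (fun f => a * S1 f + S2 f).
Proof.
move=> s1 s2; split.
  by move=> b f g bf bg; rewrite !sg_lin//; ring.
move=> F f Ff; apply: cvgD; last exact: sg_cts.
by apply: cvgM; [exact: cvg_cst|exact: sg_cts].
Qed.

Lemma signedB S1 S2 : signed S1 -> signed S2 -> signed (fun f => S1 f - S2 f).
Proof.
move=> s1 s2; move: (signed_lin (-1) s2 s1); congr signed.
by apply/funext => f; ring.
Qed.

Lemma signed0 : signed (fun=> 0).
Proof.
by split; [move=> *; rewrite mulr0 addr0|move=> *; exact: cvg_cst].
Qed.

Lemma signedN S : signed S -> signed (fun f => - S f).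
Proof.
move=> s; move: (signedB signed0 s); congr signed.
by apply/funext => f; rewrite sub0r.
Qed.

Lemma eq_signed S1 S2 : signed S1 -> signed S2 ->
  (forall B, measurable B -> S1 \1_B = S2 \1_B) ->
  forall f, bm f -> S1 f = S2 f.
Proof.
move=> s1 s2 e; apply: bm_ind => //.
  by move=> a f g bf bg h1 h2; rewrite !sg_lin// h1 h2.
move=> F f Ff e'; have := sg_cts s1 Ff; have := sg_cts s2 Ff.
under eq_cvg => n do rewrite -e'.
by move=> h1 h2; apply: cvg_unique h2 h1.
Qed.

Lemma signed_ge0 S : signed S ->
  (forall B, measurable B -> 0 <= S \1_B) ->
  forall f, bm f -> (forall x, 0 <= f x) -> 0 <= S f.
Proof.
move=> sS h; apply: bm_ind_ge0 => //.
  by move=> a f g a0 bf bg h1 h2; rewrite sg_lin// addr_ge0// mulr_ge0.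
move=> F f Ff h'; have := sg_cts sS Ff => /cvgP cv.
by rewrite -(cvg_lim _ (sg_cts sS Ff))//; apply: limr_ge => //; exact: nearW.
Qed.

Section pos_theory.
Variables (L : (Y -> R) -> R) (pL : pos L).
Let sL := pL.1.

Lemma pos_le f g : bm f -> bm g -> (forall x, f x <= g x) -> L f <= L g.
Proof.
move=> bf bg fg; rewrite -subr_ge0 -(sgB sL)//; apply: pL.2; first exact: bmB.
by move=> x; rewrite subr_ge0.
Qed.

Lemma pos_norm f : bm f -> `|L f| <= L (fun x => `|f x|).
Proof.
move=> bf; have ba := bm_abs bf; rewrite ler_norml -(sgN sL)//.
by rewrite !pos_le//; [move=> x; exact: ler_norm|exact: bmN|
  move=> x; rewrite lerNl -normrN ler_norm].
Qed.

Lemma pos1_ge0 : 0 <= L (fun=> 1).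
Proof. by apply: pL.2 => //; exact: bm_cst. Qed.

Lemma sg_cst a : L (fun=> a) = a * L (fun=> 1).
Proof.
rewrite -(sgZ sL); last exact: bm_cst.
by congr L; apply/funext => x; rewrite mulr1.
Qed.

Lemma pos_bound a f : bm f -> (forall x, `|f x| <= a) ->
  `|L f| <= a * L (fun=> 1).
Proof.
move=> bf fa; rewrite (le_trans (pos_norm bf))// -sg_cst.
by apply: pos_le => //; [exact: bm_abs|exact: bm_cst].
Qed.

Lemma pos_restr k : bm k -> (forall x, 0 <= k x) ->
  pos (fun f => L (fun x => k x * f x)).
Proof.
move=> bk k0; split; first exact: signed_restr.
by move=> f bf f0; apply: pL.2; [exact: bmM|move=> x; exact: mulr_ge0].
Qed.

End pos_theory.

Lemma posD L1 L2 : pos L1 -> pos L2 -> pos (fun f => L1 f + L2 f).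
Proof.
move=> [s1 p1] [s2 p2]; split; last by move=> f bf f0; rewrite addr_ge0// ?p1 ?p2.
move: (signed_lin 1 s1 s2); congr signed.
by apply/funext => f; rewrite mul1r.
Qed.

Lemma posZ a L : 0 <= a -> pos L -> pos (fun f => a * L f).
Proof.
move=> a0 [s p]; split; last by move=> f bf f0; rewrite mulr_ge0// p.
move: (signed_lin a s signed0); congr signed.
by apply/funext => f; rewrite addr0.
Qed.

Section hahn.
Variables (S : (Y -> R) -> R) (sS : signed S).

(** Turns the functional back into a charge, in order to import the Hahn decomposition of
    charges. *)
Definition charge_of_signed (B : set Y) : \bar R := (S \1_B)%:E.

Let nu0 : charge_of_signed set0 = 0%E.
Proof.
by congr EFin; rewrite -[RHS](sg0 sS); congr S; apply/funext => x; rewrite indic0.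
Qed.

Let nufin B : d.-measurable B -> charge_of_signed B \is a fin_num.
Proof. by []. Qed.

Let nusig : semi_sigma_additive charge_of_signed.
Proof.
move=> F mF tF mUF.
have e n x : \sum_(0 <= i < n) (\1_(F i) x : R) = \1_(\big[setU/set0]_(i < n) F i) x.
  rewrite big_mkord indicE; have [|] := boolP (_ \in _).
    rewrite inE -bigcup_mkord => -[i /= ni Fix].
    rewrite (bigD1 (Ordinal ni))//= indicE mem_set//= big1 ?addr0// => j ji.
    rewrite indicE memNset// => Fjx; move/eqP: ji; apply.
    by apply/val_inj => /=; apply: (tF _ _ _ _) => //; exists x.
  rewrite notin_setE => nF; rewrite big1// => i _; rewrite indicE memNset// => Fix.
  by apply: nF; rewrite -bigcup_mkord; exists i => //=.
have -> : (fun n => \sum_(0 <= i < n) charge_of_signed (F i))%E =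
    EFin \o (fun n => S \1_(\big[setU/set0]_(i < n) F i)).
  apply/funext => n /=; rewrite sumEFin -(sg_sum sS); last by move=> i; exact: bm_indic.
  by congr (S _)%:E; apply/funext => x; rewrite e.
by apply: cvg_EFin; [exact: nearW|exact/(sg_cts sS)/bcvg_indic_bigcup].
Qed.

HB.instance Definition _ :=
  isCharge.Build _ _ _ charge_of_signed nu0 nufin nusig.

Lemma signed_hahn : exists2 P : set Y, measurable P &
  (forall f, bm f -> (forall x, 0 <= f x) -> 0 <= S (fun x => \1_P x * f x)) /\
  (forall f, bm f -> (forall x, 0 <= f x) -> S (fun x => \1_(~` P) x * f x) <= 0).
Proof.
have [P [N [[mP hP] [mN hN] PNT PN0]]] := Hahn_decomposition charge_of_signed.
have NP : N = ~` P.
  apply/seteqP; split => x.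
    by move=> Nx Px; have : set0 x by rewrite -PN0.
  by move=> nPx; have : [set: Y] x by []; rewrite -PNT => -[].
exists P => //; split.
  apply: (@signed_ge0 (fun f => S (fun x => \1_P x * f x))).
    exact/signed_restr/bm_indic.
  move=> B mB; have mPB : measurable (P `&` B) by exact: measurableI.
  have := hP _ mPB (@subIsetl _ _ _); rewrite lee_fin; congr (_ <= S _).
  by apply/funext => x; rewrite indicI.
move=> f bf f0; rewrite -oppr_ge0.
apply: (@signed_ge0 (fun f => - S (fun x => \1_(~` P) x * f x))) => //.
  by apply: signedN; apply: signed_restr => //; exact/bm_indic/measurableC.
move=> B mB; have mPB : measurable (N `&` B) by exact: measurableI.
have := hN _ mPB (@subIsetl _ _ _); rewrite lee_fin oppr_ge0; congr (S _ <= _).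
by apply/funext => x; rewrite -NP indicI.
Qed.

End hahn.

End Functionals.

(** * Total variation norm *)

Section Norm.
Context d (Y : measurableType d) (R : realType).
Implicit Types (f g : Y -> R) (S L : (Y -> R) -> R) (B N : set Y).

(** For a Hahn set of S this is the density of S with respect to its variation |S|. *)
Definition polar B (x : Y) : R := \1_B x - \1_(~` B) x.

Lemma norm_polar B x : `|polar B x| = 1.
Proof.
rewrite /polar indic_setC indicE; case: (_ \in _) => /=.
  by rewrite subrr subr0 normr1.
by rewrite subr0 sub0r normrN1.
Qed.

Lemma polar_sqr B x : polar B x * polar B x = 1.
Proof.
rewrite /polar indic_setC indicE; case: (_ \in _) => /=.
  by rewrite subrr subr0 mulr1.
by rewrite subr0 sub0r mulrNN mulr1.
Qed.

Lemma bm1_polar B : measurable B -> bm1 (polar B).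
Proof.
move=> mB; split; last by move=> x; rewrite norm_polar.
by apply: measurable_funB; apply: measurable_indic => //; exact: measurableC.
Qed.

Lemma bm1_cst0 : bm1 (fun _ : Y => 0 : R).
Proof. by split; [exact: measurable_cst|move=> x; rewrite normr0]. Qed.

Lemma bm1N f : bm1 f -> bm1 (fun x => - f x).
Proof.
by case=> mf f1; split; [exact: measurable_funN|move=> x; rewrite normrN].
Qed.

Lemma bm1M f g : bm1 f -> bm1 g -> bm1 (fun x => f x * g x).
Proof.
case=> mf f1 [mg g1]; split; first exact: measurable_funM.
by move=> x; rewrite normrM mulr_ile1.
Qed.

(** The positive functional obtained is the variation |S|; multiplying by [polar P] once more
    recovers S, since [polar P] squares to 1. *)
Lemma signed_polar S : signed S -> exists2 P, measurable P &
  pos (fun f => S (fun x => polar P x * f x)).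
Proof.
move=> sS; have [P mP [h1 h2]] := signed_hahn sS; exists P => //.
have bP := bm1_bm (bm1_polar mP).
split; first exact: signed_restr.
move=> f bf f0; have mCP := measurableC mP.
have -> : (fun x => polar P x * f x) =
    (fun x => \1_P x * f x - \1_(~` P) x * f x).
  by apply/funext => x; rewrite /polar mulrBl.
rewrite (sgB sS); [|by apply: bmM => //; exact: bm_indic..].
by rewrite subr_ge0 (le_trans (h2 _ bf f0))// h1.
Qed.

(** The mass of |S|: the unit ball is symmetric, so the supremum of S f is that of its absolute
    value. *)
Definition nrm S : R := sup [set S f | f in @bm1 _ Y R].

(** With |S| the positive functional of the hypothesis, S f is |S| at [polar P] times f, hence at
    most |S|(1), which is S at [polar P]. *)
Lemma polar_max S P f : measurable P -> pos (fun g => S (fun x => polar P x * g x)) ->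
  bm1 f -> S f <= S (polar P).
Proof.
move=> mP pP bf; have bPf := bm1_bm (bm1M (bm1_polar mP) bf).
have -> : S f = S (fun x => polar P x * (polar P x * f x)).
  by congr S; apply/funext => x; rewrite mulrA polar_sqr mul1r.
have -> : S (polar P) = S (fun x => polar P x * 1).
  by congr S; apply/funext => x; rewrite mulr1.
apply: (pos_le pP) => //; first exact: bm_cst.
move=> x; rewrite (le_trans (ler_norm _))// normrM norm_polar mul1r.
by case: bf.
Qed.

Lemma nrm_ub S f : signed S -> bm1 f -> S f <= nrm S.
Proof.
move=> sS bf; have [P mP pP] := signed_polar sS.
apply: ub_le_sup; last by exists f.
by exists (S (polar P)) => _ [g bg <-]; exact: polar_max.
Qed.

Lemma nrm_norm S f : signed S -> bm1 f -> `|S f| <= nrm S.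
Proof.
move=> sS bf; rewrite ler_norml nrm_ub// andbT lerNl -(sgN sS)//.
  by apply: nrm_ub => //; exact: bm1N.
exact: bm1_bm.
Qed.

Lemma nrm_le S (c : R) : (forall f, bm1 f -> S f <= c) -> nrm S <= c.
Proof.
move=> h; apply: ge_sup; last by move=> _ [f bf <-]; exact: h.
by exists (S (fun=> 0)), (fun=> 0) => //; exact: bm1_cst0.
Qed.

Lemma nrm_max S : signed S -> exists f, bm1 f /\ nrm S = S f.
Proof.
move=> sS; have [P mP pP] := signed_polar sS.
have bP := bm1_polar mP; exists (polar P); split => //.
by apply/eqP; rewrite eq_le nrm_ub// nrm_le// => f; exact: polar_max.
Qed.

Lemma nrm_ge0 S : signed S -> 0 <= nrm S.
Proof.
move=> sS; rewrite -(sg0 sS); apply: nrm_ub => //; exact: bm1_cst0.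
Qed.

Lemma eq_nrm S1 S2 : (forall f, bm1 f -> S1 f = S2 f) -> nrm S1 = nrm S2.
Proof.
move=> h; congr sup; apply/seteqP; split => _ [f bf <-]; exists f => //.
  by rewrite h.
by rewrite h.
Qed.

Lemma nrmD S1 S2 : signed S1 -> signed S2 ->
  nrm (fun f => S1 f + S2 f) <= nrm S1 + nrm S2.
Proof. by move=> s1 s2; apply: nrm_le => f bf; rewrite lerD// nrm_ub. Qed.

Lemma nrm_pos L : pos L -> nrm L <= L (fun=> 1).
Proof.
move=> pL; apply: nrm_le => f bf; apply: (pos_le pL).
- exact: bm1_bm.
- exact: bm_cst.
- by move=> x; rewrite (le_trans (ler_norm _))//; case: bf.
Qed.

End Norm.

Arguments polar {d Y R} B x.

(** * Finite approximation in a countably generated sigma-algebra *)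

Section Codes.
Context d (Y : measurableType d) (R : realType).
Implicit Types (f g : Y -> R) (S L : (Y -> R) -> R) (B N : set Y).

Definition generates (U : nat -> set Y) : Prop :=
  (forall i, measurable (U i)) /\
  forall G : set (set Y), sigma_algebra setT G -> (forall i, G (U i)) ->
    forall B, measurable B -> G B.

Variable U : nat -> set Y.
Hypothesis gU : generates U.
Let mU := gU.1.

(** Codes label the atoms of the algebra generated by the first m sets of [U]; [cell b] is the
    indicator of the atom with label b. *)
Definition code m (x : Y) : {ffun 'I_m -> bool} := [ffun i : 'I_m => x \in U i].

Definition cell m (b : {ffun 'I_m -> bool}) (x : Y) : R := (code m x == b)%:R.

Lemma cellE m (b : {ffun 'I_m -> bool}) x :
  cell b x = \prod_(i < m) (\1_(if b i then U i else ~` U i) x : R).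
Proof.
rewrite /cell; case: eqP => [<-|bx].
  rewrite big1// => i _; rewrite ffunE indicE; case: ifPn => h; first by rewrite h.
  by rewrite in_setC h.
have [i bi] : exists i, b i != (x \in U i).
  apply: contrapT => h; apply: bx; apply/ffunP => i; rewrite ffunE.
  apply/eqP; rewrite eq_sym; apply: contrapT => /negP bi; apply: h; by exists i.
rewrite (bigD1 i)//= indicE; case: ifPn bi => h.
  by rewrite eq_sym eqb_id => /negbTE ->; rewrite mul0r.
by rewrite eq_sym eqbF_neg negbK in_setC => ->; rewrite mul0r.
Qed.

Lemma bm1_cell m (b : {ffun 'I_m -> bool}) : bm1 (cell b).
Proof.
split; last by move=> x; rewrite /cell; case: eqP; rewrite ?normr1 ?normr0.
rewrite (_ : cell b = fun x => \prod_(i < m) (\1_(if b i then U i else ~` U i) x : R)).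
  apply: measurable_prod => i _; apply: measurable_indic.
  by case: (b i) => //; exact: measurableC.
by apply/funext => x; rewrite cellE.
Qed.

Lemma bm_cell m (b : {ffun 'I_m -> bool}) : bm (cell b).
Proof. exact/bm1_bm/bm1_cell. Qed.

Lemma codeE m (q : {ffun 'I_m -> bool} -> R) x :
  q (code m x) = \sum_b q b * cell b x.
Proof.
rewrite (bigD1 (code m x))//= /cell eqxx mulr1 big1 ?addr0// => b.
by rewrite eq_sym => /negbTE ->; rewrite mulr0.
Qed.

Lemma bm_code m (q : {ffun 'I_m -> bool} -> R) : bm (fun x => q (code m x)).
Proof.
rewrite (_ : (fun _ => _) = fun x => \sum_b q b * cell b x).
  by apply: bm_sum => b; apply: bmZ; exact: bm_cell.
by apply/funext => x; rewrite codeE.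
Qed.

Lemma sg_code S m (q : {ffun 'I_m -> bool} -> R) f : signed S -> bm f ->
  S (fun x => q (code m x) * f x) = \sum_b q b * S (fun x => cell b x * f x).
Proof.
move=> sS bf.
rewrite (_ : (fun _ => _) = fun x => \sum_b q b * (cell b x * f x)).
  rewrite (sg_sum sS); last by move=> b; apply/bmZ/bmM => //; exact: bm_cell.
  apply: eq_bigr => b _; rewrite (sgZ sS)//; apply: bmM => //; exact: bm_cell.
apply/funext => x; rewrite codeE mulr_suml; apply: eq_bigr => b _.
by rewrite mulrA.
Qed.

Section approx.
Variables (L : (Y -> R) -> R) (pL : pos L).

(** Approximation in L1(L) by functions of the code is asked for all large m, so that two sets can
    be approximated at a common level. *)
Definition approximable B : Prop := measurable B /\ forall e : R, 0 < e ->
  exists m0, forall m, (m0 <= m)%N -> exists2 q : {ffun 'I_m -> bool} -> R,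
    (forall b, 0 <= q b <= 1) & L (fun x => `|\1_B x - q (code m x)|) <= e.

(** The indicator of a union is the maximum of the indicators, and the maximum is 1-Lipschitz in
    each variable. *)
Lemma approximableU A B : approximable A -> approximable B ->
  approximable (A `|` B).
Proof.
move=> [mA hA] [mB hB]; split; first exact: measurableU.
move=> e e0; have e2 : 0 < e / 2 by rewrite divr_gt0.
have [m1 h1] := hA _ e2; have [m2 h2] := hB _ e2.
exists (maxn m1 m2) => m; rewrite geq_max => /andP[/h1[q1 q1b hq1] /h2[q2 q2b hq2]].
exists (fun b => Num.max (q1 b) (q2 b)).
  move=> b; have /andP[? ?] := q1b b; have /andP[? ?] := q2b b.
  by rewrite le_max ge_max; apply/andP; split; [apply/orP; left|apply/andP].
have bA : bm (fun x => `|\1_A x - q1 (code m x)|).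
  by apply: bm_abs; apply: bmB; [exact: bm_indic|exact: bm_code].
have bB : bm (fun x => `|\1_B x - q2 (code m x)|).
  by apply: bm_abs; apply: bmB; [exact: bm_indic|exact: bm_code].
apply: (@le_trans _ _ (L (fun x => `|\1_A x - q1 (code m x)| +
   `|\1_B x - q2 (code m x)|))); last first.
  by rewrite (sgD pL.1)//; lra.
apply: (pos_le pL).
- apply: bm_abs; apply: bmB; first exact/bm_indic/measurableU.
  exact: (bm_code (fun b => Num.max (q1 b) (q2 b))).
- exact: bmD.
move=> x; have -> : \1_(A `|` B) x = Num.max (\1_A x) (\1_B x) :> R.
  rewrite !indicE in_setU; case: (x \in A); case: (x \in B) => /=;
  by rewrite ?maxxx// /Num.max ?ltr01 ?ltr10.
move: (\1_A x) (\1_B x) (q1 _) (q2 _) => a b c k.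
rewrite ler_norml; have := ler_norm (a - c); have := ler_norm (b - k).
have := ler_norm (c - a); have := ler_norm (k - b); rewrite (distrC c) (distrC k).
move: (normr_ge0 (a - c)) (normr_ge0 (b - k)).
by case: (ltP a b); case: (ltP c k) => *; apply/andP; split; lra.
Qed.

Lemma approximable0 : approximable set0.
Proof.
split => // e e0; exists 0%N => m _; exists (fun=> 0).
  by move=> b; rewrite lexx ler01.
rewrite (_ : (fun _ => _) = fun=> 0) ?(sg0 pL.1) ?ltW//.
by apply/funext => x; rewrite indic0 subrr normr0.
Qed.

(** The approximable sets form a sigma-algebra containing every [U i]: complements replace q by 1 -
    q, and a countable union is approached in L-measure by its finite subunions. *)
Lemma measurable_approximable B : measurable B -> approximable B.
Proof.
apply: gU.2; last first.
  move=> i; split => // e e0; exists i.+1 => m im.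
  exists (fun b : {ffun 'I_m -> bool} => (b (Ordinal im))%:R).
    by move=> b; case: (b _); rewrite /= ?lexx ?ler01.
  rewrite (_ : (fun _ => _) = fun=> 0) ?(sg0 pL.1) ?ltW//.
  by apply/funext => x; rewrite ffunE indicE subrr normr0.
split.
- exact: approximable0.
- move=> A [mA hA]; rewrite setTD; split; first exact: measurableC.
  move=> e e0; have [m0 h] := hA _ e0; exists m0 => m /h[q q01 hq].
  exists (fun b => 1 - q b).
    by move=> b; have := q01 b; rewrite subr_ge0 lerBlDr lerDl andbC.
  move: hq; congr (L _ <= _); apply/funext => x.
  by rewrite indic_setC -normrN; congr `|_|; ring.
- move=> F hF; have mF i : measurable (F i) by case: (hF i).
  have mUF : measurable (\bigcup_i F i) by exact: bigcup_measurable.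
  split => // e e0; have e2 : 0 < e / 2 by rewrite divr_gt0.
  pose V k := \big[setU/set0]_(i < k) F i.
  have hV k : approximable (V k).
    rewrite /V; elim: k => [|k IH]; first by rewrite big_ord0; exact: approximable0.
    by rewrite big_ord_recr; exact: approximableU.
  have c : L (fun x => `|\1_(\bigcup_i F i) x - \1_(V k) x|) @[k --> \oo] -->
           L (fun=> 0).
    have [mV _ cV] := bcvg_indic_bigcup R mF.
    apply: (sg_cts pL.1); split.
    + move=> k; apply: (measurableT_comp (@normr_measurable R _)) => //.
      by apply: measurable_funB; [exact: measurable_indic|exact: mV].
    + exists 1 => k x; rewrite normr_id.
      have /andP[] := @indic_01 _ Y R (\bigcup_i F i) x.
      have /andP[] := @indic_01 _ Y R (V k) x.
      by move=> *; rewrite ler_norml; apply/andP; split; lra.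
    + move=> x; rewrite -(@normr0 _ R) -(subrr (\1_(\bigcup_i F i) x)).
      by apply: cvg_norm; apply: cvgB; [exact: cvg_cst|exact: cV].
  rewrite (sg0 pL.1) in c.
  have [k hk] : exists k, L (fun x => `|\1_(\bigcup_i F i) x - \1_(V k) x|) <= e / 2.
    have /cvgrPdist_le /(_ _ e2)[k _ /(_ k (leqnn _))] := c.
    by rewrite sub0r normrN => h; exists k; rewrite (le_trans (ler_norm _)).
  have [m0 h] := (hV k).2 _ e2; exists m0 => m /h[q q01 hq]; exists q => //.
  have b1 : bm (fun x => `|\1_(\bigcup_i F i) x - \1_(V k) x : R|).
    by apply: bm_abs; apply: bmB; apply: bm_indic => //; case: (hV k).
  have b2 : bm (fun x => `|\1_(V k) x - q (code m x)|).
    by apply: bm_abs; apply: bmB; [apply: bm_indic; case: (hV k)|exact: bm_code].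
  apply: (@le_trans _ _ (L (fun x => `|\1_(\bigcup_i F i) x - \1_(V k) x| +
     `|\1_(V k) x - q (code m x)|))); last by rewrite (sgD pL.1)//; lra.
  apply: (pos_le pL); [|exact: bmD|].
    by apply: bm_abs; apply: bmB; [exact: bm_indic|exact: bm_code].
  by move=> x; rewrite ler_distD.
Qed.

End approx.

(** Testing S with the signs of its cell values bounds each sum by [nrm S]. Conversely the sign
    function [polar P] of S is, for |S|, nearly a function of the code, so large m almost attain the
    norm. *)
Lemma nrm_cvg S : signed S ->
  \sum_(b : {ffun 'I_m -> bool}) `|S (cell b)| @[m --> \oo] --> nrm S.
Proof.
move=> sS; have [P mP pP] := signed_polar sS.
have bP := bm1_polar R mP.
have ub m : \sum_(b : {ffun 'I_m -> bool}) `|S (cell b)| <= nrm S.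
  pose s (b : {ffun 'I_m -> bool}) := Num.sg (S (cell b)).
  have -> : \sum_(b : {ffun 'I_m -> bool}) `|S (cell b)| =
      S (fun x => s (code m x) * 1).
    rewrite sg_code//; last exact: bm_cst.
    apply: eq_bigr => b _; rewrite normrEsg; congr (_ * S _).
    by apply/funext => x; rewrite mulr1.
  apply: nrm_ub => //; split.
    by case: (bmM (bm_code s) (bm_cst _ 1)).
  move=> x; rewrite mulr1 /s normr_sg; by case: (_ != _).
have nP : nrm S <= S (polar P) by apply: nrm_le => f; exact: polar_max.
apply/cvgrPdist_le => e e0; have e2 : 0 < e / 2 by rewrite divr_gt0.
have [m0 h] := (measurable_approximable pP mP).2 _ e2.
exists m0 => // m /= /h[q q01 hq]; rewrite ger0_norm ?subr_ge0 ?ub//.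
rewrite lerBlDr (le_trans nP)// addrC -lerBlDr.
have bq := bm_code q.
(* [polar P] is twice the indicator of P minus 1, so q' approximates it as q approximates the
   indicator; its values lie in [-1, 1]. *)
pose q' b := 2 * q b - 1.
apply: (@le_trans _ _ (S (fun x => q' (code m x) * 1))); last first.
  rewrite sg_code//; last exact: bm_cst.
  apply: ler_sum => b _; rewrite (le_trans (ler_norm _))// normrM.
  rewrite (_ : (fun x => cell b x * 1) = cell b); last first.
    by apply/funext => x; rewrite mulr1.
  rewrite ler_piMl// ler_norml /q'; have /andP[? ?] := q01 b.
  by apply/andP; split; lra.
have bq' := bmM (bm_code q') (bm_cst Y 1).
rewrite lerBlDr addrC -lerBlDr -(sgB sS)//; last exact: bm1_bm.
have bB : bm (fun x => polar P x - q' (code m x) * 1).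
  by apply: bmB => //; exact: bm1_bm.
have -> : S (fun x => polar P x - q' (code m x) * 1) =
    S (fun x => polar P x * (polar P x * (polar P x - q' (code m x) * 1))).
  by congr S; apply/funext => x; rewrite mulrA polar_sqr mul1r.
have bI : bm (fun x => `|\1_P x - q (code m x)|).
  by apply: bm_abs; apply: bmB => //; exact: bm_indic.
apply: (@le_trans _ _ (S (fun x => polar P x * (2 * `|\1_P x - q (code m x)|)))).
  apply: (pos_le pP); [apply: bmM => //; exact: bm1_bm|exact: bmZ|].
  move=> x; rewrite (le_trans (ler_norm _))// normrM norm_polar mul1r mulr1.
  have -> : polar P x - q' (code m x) = 2 * (\1_P x - q (code m x)).
    by rewrite /polar indic_setC /q'; ring.
  by rewrite normrM (@ger0_norm _ 2).
rewrite (sgZ pP.1)//; lra.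
Qed.

(** The supremum in [nrm] ranges over uncountably many test functions; [nrm_cvg] replaces it by a
    limit of finite sums. *)
Lemma measurable_nrm (D : Y -> (Y -> R) -> R) : (forall x, signed (D x)) ->
  (forall f, bm f -> measurable_fun setT (D ^~ f)) ->
  measurable_fun setT (fun x => nrm (D x)).
Proof.
move=> sD mD; apply: (@measurable_fun_cvg _ _ _ setT
  (fun m x => \sum_(b : {ffun 'I_m -> bool}) `|D x (cell b)|)) => //.
  move=> m; apply: measurable_sum => b.
  apply: (measurableT_comp (@normr_measurable R _)) => //.
  exact/mD/bm_cell.
by move=> x _; exact: nrm_cvg.
Qed.

End Codes.

(** * Absolute continuity *)

Section Density.
Context d (Y : measurableType d) (R : realType).
Implicit Types (f g : Y -> R) (S L p La : (Y -> R) -> R) (B N : set Y).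

(** Absolute continuity p << L, with the reference measure first. *)
Definition dominated L p : Prop :=
  forall N, measurable N -> L \1_N = 0 -> p \1_N = 0.

Definition steps (dl : R) (K : nat) (P : nat -> set Y) (x : Y) : R :=
  \sum_(k < K) dl * \1_(P k) x.

Lemma bm_steps dl K P : (forall k, measurable (P k)) -> bm (steps dl K P).
Proof.
by move=> mP; apply: bm_sum => k; apply: bmZ; exact: bm_indic.
Qed.

(** The functions min(n g, 1) increase to the indicator of {g > 0}, and their integrals are at most
    n L g = 0. *)
Lemma pos_null_support L g : pos L -> bm g -> (forall x, 0 <= g x) ->
  L g = 0 -> measurable [set x | 0 < g x] /\ L \1_[set x | 0 < g x] = 0.
Proof.
move=> pL bg g0 Lg; set N := [set x | 0 < g x].
have mN : measurable N.
  have -> : N = ~` [set x | 0 <= -1 * g x].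
    by apply/seteqP; split => x; rewrite /N/= mulN1r oppr_ge0 ltNge => /negP.
  by apply/measurableC/measurable_level; case: bg.
split => //.
have c : bcvg (fun n x => Num.min (n%:R * g x) 1) \1_N.
  split.
  - move=> n; apply: measurable_minr; last exact: measurable_cst.
    by case: (bmZ n%:R bg).
  - exists 1 => n x; rewrite ger0_norm; first by rewrite ge_min lexx orbT.
    by rewrite le_min ler01 andbT mulr_ge0.
  - move=> x; apply: (@cvg_near_cst _ _ _ _ _).
    have [gx|gx] := ltP 0 (g x); last first.
      apply: nearW => n; rewrite indicE memNset ?mulr0n; last first.
        by rewrite /N/= ltNge gx.
      have -> : g x = 0 by apply/eqP; rewrite eq_le gx g0.
      by rewrite mulr0 min_l.
    exists (Num.trunc (g x)^-1).+1 => // n /= hn.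
    rewrite indicE mem_set//= min_r//.
    rewrite -ler_pdivrMr// mul1r (le_trans (ltW (truncnS_gt _)))// ler_nat//.
apply: (@cvg_unique _ _ (L (fun x => Num.min (n%:R * g x) 1) @[n --> \oo])) => //.
  exact: (sg_cts pL.1 c).
apply: (@cvg_near_cst _ _ _ _ _); apply: nearW => n.
have bn : bm (fun x => Num.min (n%:R * g x) 1).
  split; first by case: c => h _ _; exact: h.
  exists 1 => x; rewrite ger0_norm; first by rewrite ge_min lexx orbT.
  by rewrite le_min ler01 andbT mulr_ge0.
apply/eqP; rewrite eq_le; apply/andP; split.
  rewrite -[leRHS](mulr0 n%:R) -{1}Lg -(sgZ pL.1)//.
  by apply: (pos_le pL) => //; [exact: bmZ|move=> x; rewrite ge_min lexx].
by apply: pL.2 => // x; rewrite le_min ler01 andbT mulr_ge0.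
Qed.

Lemma pos_null_le L f g : pos L -> bm f -> bm g -> (forall x, 0 <= f x <= g x) ->
  L g = 0 -> L f = 0.
Proof.
move=> pL bf bg fg Lg; apply/eqP; rewrite eq_le -{1}Lg; apply/andP; split.
  by apply: (pos_le pL) => // x; have /andP[] := fg x.
by apply: pL.2 => // x; have /andP[] := fg x.
Qed.

Lemma pos_null_bigcup L (F : nat -> set Y) : pos L ->
  (forall k, measurable (F k)) -> (forall k, L \1_(F k) = 0) ->
  L \1_(\bigcup_k F k) = 0.
Proof.
move=> pL mF LF; pose V k := \big[setU/set0]_(i < k) F i.
have mV k : measurable (V k) by exact: bigsetU_measurable.
have c : bcvg (fun k => \1_(V k) : Y -> R) \1_(\bigcup_k F k).
  exact: bcvg_indic_bigcup.
apply: (@cvg_unique _ _ (L \1_(V k) @[k --> \oo])) => //.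
  exact: (sg_cts pL.1 c).
apply: (@cvg_near_cst _ _ _ _ _); apply: nearW => n.
rewrite /V; elim: n => [|n IH].
  by rewrite big_ord0 -[RHS](sg0 pL.1); congr L; apply/funext => x; rewrite indic0.
have bn : bm (\1_(V n) : Y -> R) by exact: bm_indic.
have bF : bm (\1_(F n) : Y -> R) by exact: bm_indic.
apply: (pos_null_le (g := fun x => \1_(V n) x + \1_(F n) x) pL).
- exact: (bm_indic _ (mV n.+1)).
- exact: bmD.
- move=> x; rewrite indic_ge0 /= big_ord_recr/= -/(V n) !indicE in_setU.
  by case: (x \in V n); case: (x \in F n); rewrite /= ?addr0 ?add0r ?lexx// lerDl.
- by rewrite (sgD pL.1)// IH LF addr0.
Qed.

(* The steps are nested Hahn sets: p lies between k dl L and (k+1) dl L on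
   the k-th layer. *)
Lemma dominated_steps p L : pos p -> pos L -> dominated L p ->
  forall e : R, 0 < e -> exists (dl : R) (K : nat) (P : nat -> set Y),
  [/\ 0 <= dl, forall k, measurable (P k),
      forall f, bm f -> (forall x, 0 <= f x) ->
        L (fun x => steps dl K P x * f x) <= p f &
      p (fun=> 1) - L (steps dl K P) <= e].
Proof.
move=> pp pL domL e e0.
pose L1 := L (fun=> 1); have L10 : 0 <= L1 by exact: pos1_ge0.
(* Off the top layer the error is one step height, at most dl L(1); the other e / 2 is kept for the
   top layer. The 1 in the denominator covers L(1) = 0. *)
have [dl dl0 dlL] : exists2 dl : R, 0 < dl & dl * L1 <= e / 2.
  exists (e / 2 / (L1 + 1)); first by rewrite !divr_gt0// ltr_wpDl.
  rewrite -mulrA ler_piMr//; first by rewrite divr_ge0// ltW.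
  by rewrite mulrC ler_pdivrMr ?ltr_wpDl// mul1r lerDl.
have /choice[H hH] : forall k, exists Hk : set Y, [/\ measurable Hk,
   forall f, bm f -> (forall x, 0 <= f x) ->
     k.+1%:R * dl * L (fun x => \1_Hk x * f x) <= p (fun x => \1_Hk x * f x) &
   forall f, bm f -> (forall x, 0 <= f x) ->
     p (fun x => \1_(~` Hk) x * f x) <=
     k.+1%:R * dl * L (fun x => \1_(~` Hk) x * f x)].
  move=> k.
  have sS := signedB pp.1 (signed_lin (k.+1%:R * dl) pL.1 (@signed0 _ Y R)).
  have [P mP [h1 h2]] := signed_hahn sS; exists P; split => // f bf f0.
    by have := h1 f bf f0; rewrite addr0 subr_ge0.
  by have := h2 f bf f0; rewrite addr0 subr_le0.
have mH k : measurable (H k) by case: (hH k).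
(* [Q k] is the intersection of the first k sets [H], so p >= k dl L on it. As [P k] is [Q k.+1],
   the steps add up to K dl on [Q K]. *)
pose Q := fix Q k := if k is k'.+1 then Q k' `&` H k' else setT.
have mQ k : measurable (Q k) by elim: k => //= k IH; exact: measurableI.
pose P k := Q k.+1; have mP k : measurable (P k) by exact: mQ.
have bQ k : bm (\1_(Q k) : Y -> R) by exact: bm_indic.
have bCH k : bm (\1_(~` H k) : Y -> R) by exact/bm_indic/measurableC.
have bCQ k : bm (\1_(~` Q k) : Y -> R) by exact/bm_indic/measurableC.
have bH k : bm (\1_(H k) : Y -> R) by exact: bm_indic.
have J K f : bm f -> (forall x, 0 <= f x) ->
    K%:R * dl * L (fun x => \1_(Q K) x * f x) <= p (fun x => \1_(Q K) x * f x).
  move=> bf f0; case: K => [|k].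
    rewrite !mul0r; apply: pp.2; first exact: bmM.
    by move=> x; rewrite mulr_ge0// indic_ge0.
  have [_ h _] := hH k.
  have eH : (fun x => \1_(H k) x * (\1_(Q k.+1) x * f x)) =
      (fun x => \1_(Q k.+1) x * f x).
    apply/funext => x; rewrite /= mulrA; congr (_ * _).
    by rewrite -indic_setI setICA setIid.
  have := h _ (bmM (bQ k.+1) bf); rewrite eH; apply => x.
  by rewrite mulr_ge0// indic_ge0.
have gQ K x : steps dl K P x * \1_(Q K) x = K%:R * dl * \1_(Q K) x.
  elim: K => [|K IH]; first by rewrite /steps big_ord0 !mul0r.
  rewrite /steps big_ord_recr/= -/(steps dl K P x) -/(Q K) mulrDl -mulrA.
  rewrite -/(Q K.+1) -/(P K) indic_sqr {1}/P /= indic_setI mulrA IH.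
  by rewrite -natr1; ring.
have bst K : bm (steps dl K P) by exact: bm_steps.
have I K f : bm f -> (forall x, 0 <= f x) ->
    0 <= p (fun x => \1_(~` Q K) x * f x) -
      L (fun x => steps dl K P x * (\1_(~` Q K) x * f x)) <=
    dl * L (fun x => \1_(~` Q K) x * f x).
  move=> bf f0; elim: K => [|K IH].
    have z (h : Y -> R) : (fun x => h x * (\1_(~` Q 0) x * f x)) = fun=> 0.
      by apply/funext => x; rewrite /= setCT indic0 mul0r mulr0.
    have z' : (fun x => \1_(~` Q 0) x * f x) = fun=> 0.
      by apply/funext => x; rewrite /= setCT indic0 mul0r.
    by rewrite z z' (sg0 pp.1) (sg0 pL.1) subrr mulr0 lexx.
  pose h x := \1_(Q K) x * (\1_(~` H K) x * f x).
  have bh : bm h by apply: bmM => //; exact: bmM.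
  have e1 : (fun x => \1_(~` Q K.+1) x * f x) =
      (fun x => \1_(~` Q K) x * f x + h x).
    apply/funext => x; rewrite /h /= !indic_setC indic_setI; ring.
  have e2 : (fun x => steps dl K.+1 P x * (\1_(~` Q K.+1) x * f x)) =
      (fun x => steps dl K P x * (\1_(~` Q K) x * f x) + K%:R * dl * h x).
    apply/funext => x; rewrite /steps big_ord_recr/= -/(steps dl K P x).
    rewrite indic_setC.
    have q : \1_(P K) x * (1 - \1_(P K) x) = 0 :> R.
      by rewrite mulrBr mulr1 indic_sqr subrr.
    transitivity (steps dl K P x * ((1 - \1_(P K) x) * f x) +
      dl * f x * (\1_(P K) x * (1 - \1_(P K) x))).
      by rewrite /P; ring.
    have eP : \1_(P K) x = \1_(Q K) x * \1_(H K) x :> R by rewrite -indic_setI.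
    rewrite q /h (mulrA (K%:R * dl) (\1_(Q K) x)) -gQ !eP !indic_setC; ring.
  have bCf : bm (fun x => \1_(~` Q K) x * f x) by exact: bmM.
  rewrite e1 e2 (sgD pp.1)// !(sgD pL.1)//; last 2 first.
  - exact: bmM.
  - exact: bmZ.
  rewrite (sgZ pL.1)//.
  have j1 : K%:R * dl * L h <= p h.
    by apply: J; [exact: bmM|move=> x; rewrite mulr_ge0// indic_ge0].
  have j2 : p h <= K.+1%:R * dl * L h.
    have eh : (fun x => \1_(~` H K) x * (\1_(Q K) x * f x)) = h.
      by apply/funext => x; rewrite /h; ring.
    have [_ _ j] := hH K; have := j _ (bmM (bQ K) bf); rewrite eh; apply => x.
    by rewrite mulr_ge0// indic_ge0.
  move: j2; rewrite -natr1 !mulrDl mul1r => j2.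
  by case/andP: IH => i1 i2; rewrite mulrDr; apply/andP; split; lra.
have split1 K f : bm f -> p f = p (fun x => \1_(~` Q K) x * f x) + p (fun x => \1_(Q K) x * f x).
  move=> bf; rewrite -(sgD pp.1); [|exact: bmM..].
  by congr p; apply/funext => x; rewrite indic_setC; ring.
have split2 K f : bm f -> L (fun x => steps dl K P x * f x) =
    L (fun x => steps dl K P x * (\1_(~` Q K) x * f x)) +
    K%:R * dl * L (fun x => \1_(Q K) x * f x).
  move=> bf; rewrite -(sgZ pL.1); last exact: bmM.
  rewrite -(sgD pL.1); [|by do 2!apply: bmM => //|by apply: bmZ; exact: bmM].
  congr L; apply/funext => x.
  rewrite (mulrA (K%:R * dl) (\1_(Q K) x)) -gQ indic_setC; ring.
have b1 : bm (fun _ : Y => 1 : R) by exact: bm_cst.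
(* L(Q k) <= p(1) / (k dl), so the intersection of the [Q k] is L-null, hence p-null by domination:
   p has no infinite layer. *)
have pQ : p \1_(Q k) @[k --> \oo] --> (0 : R).
  have mI : measurable (\bigcap_k Q k) by exact: bigcap_measurable.
  have LI : L \1_(\bigcap_k Q k) = 0.
    apply/eqP; rewrite eq_le; apply/andP; split; last first.
      by apply: pL.2; [exact: bm_indic|move=> x; exact: indic_ge0].
    apply/ler_addgt0Pr => t t0; rewrite add0r.
    have p10 : 0 <= p (fun=> 1) by exact: pos1_ge0.
    pose k := (Num.trunc (p (fun=> 1) / dl / t)).+1.
    have kt : p (fun=> 1) / dl / t < k%:R by exact: truncnS_gt.
    have k0 : 0 < k%:R :> R by rewrite ltr0n.
    apply: (@le_trans _ _ (L \1_(Q k))).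
      apply: (pos_le pL) => //; first exact: bm_indic.
      move=> x; rewrite !indicE; case: (boolP (x \in \bigcap_k0 Q k0)) => //.
      by rewrite inE => h; rewrite mem_set//; exact: h.
    have := J k _ b1 (fun=> ler01).
    rewrite (_ : (fun x => \1_(Q k) x * 1) = \1_(Q k)); last first.
      by apply/funext => x; rewrite mulr1.
    move=> h; have {}h : k%:R * dl * L \1_(Q k) <= p (fun=> 1).
      rewrite (le_trans h)//; apply: (pos_le pp) => // x; exact: indic_le1.
    move: kt; rewrite !ltr_pdivrMr// => kt.
    rewrite -(ler_pM2l (mulr_gt0 k0 dl0)) (le_trans h)//.
    by rewrite ltW// (lt_le_trans kt)// mulrAC.
  have c : bcvg (fun k => \1_(Q k) : Y -> R) \1_(\bigcap_k Q k).
    split; first by move=> k; exact: measurable_indic.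
      by exists 1 => k x; rewrite ger0_norm ?indic_le1 ?indic_ge0.
    move=> x; apply: (@cvg_near_cst _ _ _ _ _).
    have [h|h] := pselect ((\bigcap_k Q k) x).
      by apply: nearW => k; rewrite !indicE !mem_set//; exact: h.
    have [k0 hk0] : exists k, ~ Q k x.
      by apply: contrapT => h'; apply: h => k _; apply: contrapT => h''; apply: h'; exists k.
    exists k0 => // k /= k0k; rewrite !indicE !memNset// => Qk; apply: hk0.
    rewrite -(subnK k0k) in Qk; elim: (k - k0)%N Qk => //= n IH [h1 _].
    exact: IH.
  by have := sg_cts pp.1 c; rewrite (domL _ mI LI).
have e2 : 0 < e / 2 by rewrite divr_gt0.
have /cvgrPdist_le/(_ _ e2)[K _ /(_ K (leqnn K))] := pQ.
rewrite sub0r normrN => hK.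
exists dl, K, P; split; [exact: ltW|by []| |].
  move=> f bf f0; rewrite split2// (split1 K)//.
  have /andP[i1 i2] := I K f bf f0; have := J K f bf f0; lra.
have -> : L (steps dl K P) = L (fun x => steps dl K P x * 1).
  by congr L; apply/funext => x; rewrite mulr1.
rewrite split2// (split1 K)//.
have /andP[i1 i2] := I K _ b1 (fun=> ler01); have := J K _ b1 (fun=> ler01).
have l1 : L (fun x => \1_(~` Q K) x * 1) <= L1.
  apply: (pos_le pL); [exact: bmM|by []|by move=> x; rewrite mulr1 indic_le1].
have l2 : p (fun x => \1_(Q K) x * 1) = p \1_(Q K).
  by congr p; apply/funext => x; rewrite mulr1.
have l3 : dl * L (fun x => \1_(~` Q K) x * 1) <= dl * L1 by rewrite ler_pM2l.
have l4 : 0 <= K%:R * dl * L (fun x => \1_(Q K) x * 1).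
  rewrite mulr_ge0//; first by rewrite mulr_ge0// ltW.
  by apply: pL.2; [exact: bmM|move=> x; rewrite mulr1 indic_ge0].
have := ler_norm (p \1_(Q K)).
move: l2 => ->; lra.
Qed.

End Density.

(** * From setwise to norm convergence *)

Section Rank.
Context d (Y : measurableType d) (R : realType).
Implicit Types (f g : Y -> R) (S L p : (Y -> R) -> R) (B N : set Y).

Record markov_op (Q : (Y -> R) -> Y -> R) : Prop := Markov {
  mk_pos : forall x, pos (fun f => Q f x) ;
  mk_one : Q (fun=> 1) = fun=> 1 ;
  mk_bm : forall f, bm f -> bm (Q f) }.

Lemma mk_bm1 Q f : markov_op Q -> bm1 f -> bm1 (Q f).
Proof.
move=> kQ bf; split; first by case: (mk_bm kQ (bm1_bm bf)).
move=> x; have := pos_bound (mk_pos kQ x) (bm1_bm bf) bf.2.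
by rewrite mul1r (mk_one kQ).
Qed.

Lemma bcvg_markov Q (F : nat -> Y -> R) f : markov_op Q -> bcvg F f ->
  bcvg (fun n => Q (F n)) (Q f).
Proof.
move=> kQ Ff; have [mF [M FM] _] := Ff.
have bF n : bm (F n) by split => //; exists M.
split.
- by move=> n; case: (mk_bm kQ (bF n)).
- exists M => n x; have := pos_bound (mk_pos kQ x) (bF n) (FM n).
  by rewrite (mk_one kQ) mulr1.
- by move=> x; exact: (sg_cts (mk_pos kQ x).1).
Qed.

Lemma signed_markov Q S : markov_op Q -> signed S -> signed (fun f => S (Q f)).
Proof.
move=> kQ sS; split.
  move=> a f g bf bg; rewrite -(sg_lin sS); [|exact: mk_bm..].
  congr S; apply/funext => x; exact: (sg_lin (mk_pos kQ x).1).
by move=> F f Ff; apply: (sg_cts sS); exact: bcvg_markov.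
Qed.

Lemma pos_markov Q L : markov_op Q -> pos L -> pos (fun f => L (Q f)).
Proof.
move=> kQ [sL pL]; split; first exact: signed_markov.
move=> f bf f0; apply: pL; first exact: mk_bm.
by move=> x; apply: (mk_pos kQ x).2.
Qed.

Lemma signed_sum (I : Type) (r : seq I) (T : I -> (Y -> R) -> R) :
  (forall i, signed (T i)) -> signed (fun f => \sum_(i <- r) T i f).
Proof.
move=> sT; elim: r => [|i r IH].
  by move: (@signed0 _ Y R); congr signed; apply/funext => f; rewrite big_nil.
move: (signed_lin 1 (sT i) IH); congr signed; apply/funext => f.
by rewrite big_cons mul1r.
Qed.

Lemma cvg_sumr (I : Type) (r : seq I) (F : I -> nat -> R) (l : I -> R) :
  (forall i, F i n @[n --> \oo] --> l i) ->
  \sum_(i <- r) F i n @[n --> \oo] --> \sum_(i <- r) l i.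
Proof.
move=> Fl; elim: r => [|i r IH].
  by rewrite big_nil; under eq_cvg do rewrite big_nil; exact: cvg_cst.
rewrite big_cons; under eq_cvg do rewrite big_cons.
by apply: cvgD => //; exact: Fl.
Qed.

Variable U : nat -> set Y.
Hypothesis gU : generates U.

Local Notation cell b := (cell R U b).

Section rank.
Variables (L : (Y -> R) -> R) (pL : pos L).

(** The conditional expectation of f on the cell b under L. On an L-null cell the division by zero
    gives 0, and [meanE] still holds. *)
Definition mean m (b : {ffun 'I_m -> bool}) f : R :=
  L (fun x => cell b x * f x) / L (cell b).

(** The measure that gives each L-charged cell its p-mass, spread proportionally to L; p enters
    through finitely many numbers only. *)
Definition rank p m f : R := \sum_(b : {ffun 'I_m -> bool}) p (cell b) * mean b f.

Lemma cell_ge0 m (b : {ffun 'I_m -> bool}) x : 0 <= cell b x.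
Proof. exact: ler0n. Qed.

Lemma mean_bound m (b : {ffun 'I_m -> bool}) f : bm1 f ->
  `|L (fun x => cell b x * f x)| <= L (cell b).
Proof.
move=> bf; have bb := bm_cell R gU b; have bfb := bmM bb (bm1_bm bf).
rewrite (le_trans (pos_norm pL bfb))//; apply: (pos_le pL) => //.
  exact: bm_abs.
by move=> x; rewrite normrM ger0_norm ?cell_ge0// ler_piMr ?cell_ge0//; case: bf.
Qed.

Lemma meanE m (b : {ffun 'I_m -> bool}) f : bm1 f ->
  L (fun x => cell b x * f x) = L (cell b) * mean b f.
Proof.
move=> bf; rewrite /mean; have := mean_bound b bf.
have [->|n0] := eqVneq (L (cell b)) 0.
  by rewrite normr_le0 mul0r => /eqP.
by rewrite mulrCA divff// mulr1.
Qed.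

Lemma mean_le1 m (b : {ffun 'I_m -> bool}) f : bm1 f -> `|mean b f| <= 1.
Proof.
move=> bf; rewrite /mean normrM normfV.
have b0 : 0 <= L (cell b) by apply: pL.2; [exact: bm_cell|exact: cell_ge0].
rewrite (ger0_norm b0); have [->|n0] := eqVneq (L (cell b)) 0.
  by rewrite invr0 mulr0.
have {}b0 : 0 < L (cell b) by rewrite lt_neqAle eq_sym n0.
by rewrite ler_pdivrMr// mul1r mean_bound.
Qed.

Lemma signed_rank p m : signed (rank p m).
Proof.
apply: signed_sum => b.
move: (signed_lin (p (cell b) / L (cell b)) (signed_restr pL.1 (bm_cell R gU b))
  (@signed0 _ Y R)); congr signed; apply/funext => f.
by rewrite addr0 /mean mulrA mulrAC.
Qed.

Lemma steps_approx (dl : R) K (P : nat -> set Y) : 0 <= dl ->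
  (forall k, measurable (P k)) -> forall e : R, 0 < e ->
  exists m0, forall m, (m0 <= m)%N -> exists q : {ffun 'I_m -> bool} -> R,
    L (fun x => `|steps dl K P x - q (code U m x)|) <= e.
Proof.
move=> dl0 mP; elim: K => [|K IH] e e0.
  exists 0%N => m _; exists (fun=> 0).
  rewrite (_ : (fun _ => _) = fun=> 0) ?(sg0 pL.1) ?ltW//.
  by apply/funext => x; rewrite /steps big_ord0 subrr normr0.
have e2 : 0 < e / 2 by rewrite divr_gt0.
(* The step height dl may be 0, hence the division by dl + 1. *)
have e3 : 0 < e / 2 / (dl + 1) by rewrite !divr_gt0// ltr_wpDl.
have [m1 h1] := IH _ e2.
have [m2 h2] := (measurable_approximable gU pL (mP K)).2 _ e3.
exists (maxn m1 m2) => m; rewrite geq_max => /andP[/h1[q1 hq1] /h2[q2 _ hq2]].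
exists (fun b => q1 b + dl * q2 b).
have b1 : bm (fun x => `|steps dl K P x - q1 (code U m x)|).
  by apply: bm_abs; apply: bmB; [exact: bm_steps|exact: bm_code].
have b2 : bm (fun x => `|\1_(P K) x - q2 (code U m x)|).
  by apply: bm_abs; apply: bmB; [exact: bm_indic|exact: bm_code].
apply: (@le_trans _ _ (L (fun x => dl * `|\1_(P K) x - q2 (code U m x)| +
   `|steps dl K P x - q1 (code U m x)|))).
  apply: (pos_le pL).
  - apply: bm_abs; apply: bmB; first exact: bm_steps.
    exact: (bm_code gU (fun b => q1 b + dl * q2 b)).
  - by apply: bmD => //; exact: bmZ.
  move=> x; rewrite -{3}(ger0_norm dl0) -normrM (le_trans _ (ler_normD _ _))//.
  rewrite le_eqVlt; apply/orP; left; apply/eqP; congr `|_|.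
  rewrite /steps big_ord_recr/=; ring.
rewrite (sg_lin pL.1)//.
have : dl * L (fun x => `|\1_(P K) x - q2 (code U m x)|) <= e / 2.
  apply: (le_trans (ler_wpM2l dl0 hq2)); rewrite mulrCA ler_piMr ?(ltW e2)//.
  by rewrite ler_pdivrMr ?mul1r ?ltr_wpDl// lerDl.
lra.
Qed.

(** p is close to a step function times L, and that to q(code) times L, which differs from [rank] by
    at most the sum over cells of |q L(cell) - p(cell)|. This sum is again a difference of the two
    measures, at a sign function of the code. So the two errors of e / 4 are paid once for f and
    once for the sign function. *)
Lemma rank_cvg p : pos p -> dominated L p ->
  nrm (fun f => p f - rank p m f) @[m --> \oo] --> (0 : R).
Proof.
move=> pp domL; apply/cvgrPdist_le => e e0.
have e4 : 0 < e / 4 by rewrite divr_gt0.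
have [dl [K [P [dl0 mP Pp P1]]]] := dominated_steps pp pL domL e4.
have bst : bm (steps dl K P) by exact: bm_steps.
have [m0 h] := steps_approx K dl0 mP e4.
exists m0 => // m /= /h[q hq]; have bq := bm_code gU q.
have sD : signed (fun f => p f - rank p m f).
  by apply: signedB; [exact: pp.1|exact: signed_rank].
rewrite sub0r normrN ger0_norm ?nrm_ge0//; apply: nrm_le => f bf.
have A g : bm1 g -> `|p g - L (fun x => steps dl K P x * g x)| <= e / 4.
  move=> bg; have bg' := bm1_bm bg.
  pose w f := p f - L (fun x => steps dl K P x * f x).
  have pw : pos w.
    split; first by apply: signedB; [exact: pp.1|exact: (signed_restr pL.1)].
    by move=> k bk k0; rewrite subr_ge0; exact: Pp.
  apply: (le_trans (pos_bound pw bg' bg.2)); rewrite mul1r /w.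
  by rewrite (_ : (fun x => _ * 1) = steps dl K P)//; apply/funext => x; rewrite mulr1.
have B g : bm1 g -> `|L (fun x => steps dl K P x * g x) -
    L (fun x => q (code U m x) * g x)| <= e / 4.
  move=> bg; have bg' := bm1_bm bg.
  rewrite -(sgB pL.1); [|exact: bmM..].
  have bb : bm (fun x => steps dl K P x * g x - q (code U m x) * g x).
    by apply: bmB; exact: bmM.
  rewrite (le_trans (pos_norm pL bb))// (le_trans _ hq)//.
  apply: (pos_le pL); [exact: bm_abs|by apply: bm_abs; exact: bmB|].
  by move=> x; rewrite -mulrBl normrM ler_piMr//; case: bg.
pose s (b : {ffun 'I_m -> bool}) := Num.sg (q b * L (cell b) - p (cell b)).
have bs : bm1 (fun x => s (code U m x)).
  split; first by case: (bm_code gU s).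
  by move=> x; rewrite /s normr_sg; case: (_ != _).
have C : \sum_b `|q b * L (cell b) - p (cell b)| =
    L (fun x => q (code U m x) * s (code U m x)) - p (fun x => s (code U m x)).
  have -> : (fun x => q (code U m x) * s (code U m x)) =
      (fun x => (fun b => q b * s b) (code U m x) * 1).
    by apply/funext => x; rewrite mulr1.
  have -> : (fun x => s (code U m x)) = (fun x => s (code U m x) * 1).
    by apply/funext => x; rewrite mulr1.
  rewrite (sg_code gU (fun b => q b * s b) pL.1 (bm_cst Y 1)).
  rewrite (sg_code gU s pp.1 (bm_cst Y 1)) -sumrB; apply: eq_bigr => b _.
  rewrite (_ : (fun x => cell b x * 1) = cell b); last first.
    by apply/funext => x; rewrite mulr1.
  by rewrite normrEsg -/(s b) mulrBr; congr (_ - _); ring.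
have D : L (fun x => q (code U m x) * f x) - rank p m f <=
    \sum_b `|q b * L (cell b) - p (cell b)|.
  rewrite (sg_code gU q pL.1 (bm1_bm bf)) /rank -sumrB; apply: ler_sum => b _.
  rewrite meanE// mulrA -mulrBl (le_trans (ler_norm _))// normrM.
  by rewrite ler_piMr// mean_le1.
move: (A _ bf) (B _ bf) (A _ bs) (B _ bs) D; rewrite C.
rewrite !ler_norml => /andP[? ?] /andP[? ?] /andP[? ?] /andP[? ?]; lra.
Qed.

End rank.

(* Weak convergence is improved to norm convergence: Q is approximated by the
   finite-rank operators f |-> sum_b Q (cell b) mean b f, uniformly up to a set
   of small mass. *)
Lemma setwise_norm_cvg (L : (Y -> R) -> R) Q (al : nat -> (Y -> R) -> R)
    (be : (Y -> R) -> R) :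
  markov_op Q -> pos L -> (forall x, dominated L (fun f => Q f x)) ->
  (forall n, pos (al n)) -> pos be ->
  (forall f, bm f -> al n f @[n --> \oo] --> be f) ->
  nrm (fun f => al n (Q f) - be (Q f)) @[n --> \oo] --> (0 : R).
Proof.
move=> kQ pL domL pal pbe cal.
pose D m x f := Q f x - rank L (fun f => Q f x) m f.
have sD m x : signed (D m x).
  by apply: signedB; [exact: (mk_pos kQ x).1|exact: signed_rank].
have bQc m (b : {ffun 'I_m -> bool}) : bm (Q (cell b)) by exact/mk_bm/bm_cell.
have brank m f : bm (fun x => rank L (fun f => Q f x) m f).
  apply: bm_sum => b; exact/bmM/bm_cst.
have bD m f : bm f -> bm (fun x => D m x f).
  by move=> bf; apply: bmB => //; exact: mk_bm.
(* The error of the finite-rank approximation at x. It tends to 0 for each x without uniformity, so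
   it is measured through [be] and not through a supremum. *)
pose psi m x := nrm (D m x).
have psi0 m x : 0 <= psi m x by exact: nrm_ge0.
have psi2 m x : psi m x <= 2.
  apply: nrm_le => f bf; rewrite /D.
  have h1 : `|Q f x| <= 1 by case: (mk_bm1 kQ bf).
  have h2 : `|rank L (fun f => Q f x) m f| <= 1.
    rewrite (le_trans (ler_norm_sum _ _ _))//.
    have -> : 1 = \sum_(b : {ffun 'I_m -> bool}) Q (cell b) x.
      rewrite -(sg_sum (mk_pos kQ x).1); last by move=> b; exact: bm_cell.
      rewrite -[LHS]/((fun=> 1) x) -(mk_one kQ).
      congr (Q _ x); apply/funext => y.
      rewrite [LHS](codeE U (fun _ : {ffun 'I_m -> bool} => 1) y).
      by apply: eq_bigr => b _; rewrite mul1r.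
    apply: ler_sum => b _; rewrite normrM ger0_norm; last first.
      by apply: (mk_pos kQ x).2; [exact: bm_cell|exact: cell_ge0].
    rewrite ler_piMr ?mean_le1//.
    by apply: (mk_pos kQ x).2; [exact: bm_cell|exact: cell_ge0].
  by move: h1 h2; rewrite !ler_norml => /andP[? ?] /andP[? ?]; lra.
have mpsi m : measurable_fun setT (psi m).
  by apply: (measurable_nrm gU (sD m)) => f bf; case: (bD m f bf).
have bpsi m : bm (psi m).
  by split => //; exists 2 => x; rewrite ger0_norm.
have cpsi : be (psi m) @[m --> \oo] --> (0 : R).
  rewrite -(sg0 pbe.1); apply: (sg_cts pbe.1); split => //.
    by exists 2 => m x; rewrite ger0_norm.
  move=> x; exact: (rank_cvg pL (mk_pos kQ x) (domL x)).
have sN n : signed (fun f => al n (Q f) - be (Q f)).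
  by apply: signedB; apply: signed_markov => //; [exact: (pal n).1|exact: pbe.1].
(* m is fixed through [be] first; then setwise convergence at [psi m] and at the finitely many
   [Q (cell b)] transfers the smallness to [al n]. *)
apply/cvgrPdist_le => e e0; have e4 : 0 < e / 4 by rewrite divr_gt0.
have /cvgrPdist_le/(_ _ e4)[m _ /(_ m (leqnn m))] := cpsi.
rewrite sub0r normrN => /(le_trans (ler_norm _)) hm.
have c1 : \sum_(b : {ffun 'I_m -> bool}) `|al n (Q (cell b)) - be (Q (cell b))|
    @[n --> \oo] --> (0 : R).
  rewrite [X in _ --> X](_ : 0 = \sum_(b : {ffun 'I_m -> bool}) (0 : R)); last first.
    by rewrite big1.
  apply: cvg_sumr => b; rewrite -(@normr0 _ R).
  apply: cvg_norm; rewrite -(subrr (be (Q (cell b)))).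
  by apply: cvgB; [exact: cal|exact: cvg_cst].
have /cvgrPdist_le/(_ _ e4)[n1 _ h1] := c1.
have /cvgrPdist_le/(_ _ e4)[n2 _ h2] := cal _ (bpsi m).
exists (maxn n1 n2) => // n /=; rewrite geq_max => /andP[/h1 + /h2].
rewrite sub0r normrN => /(le_trans (ler_norm _)) hn1.
rewrite ler_norml => /andP[hn2 _].
rewrite sub0r normrN ger0_norm ?nrm_ge0//; apply: nrm_le => f bf.
have E la : pos la -> la (Q f) = la (fun x => D m x f) +
    \sum_(b : {ffun 'I_m -> bool}) la (Q (cell b)) * mean L b f.
  move=> pla; have -> : Q f = (fun x => D m x f + rank L (fun f => Q f x) m f).
    by apply/funext => x; rewrite /D subrK.
  rewrite (sgD pla.1)//; last exact/bD/bm1_bm.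
  rewrite /rank (sg_sum pla.1); last by move=> b; exact/bmM/bm_cst.
  congr (_ + _); apply: eq_bigr => b _; rewrite mulrC -(sgZ pla.1)//.
  by congr la; apply/funext => x; rewrite mulrC.
have F la : pos la -> `|la (fun x => D m x f)| <= la (psi m).
  move=> pla; rewrite (le_trans (pos_norm pla (bD _ _ (bm1_bm bf))))//.
  apply: (pos_le pla) => //; first by apply: bm_abs; exact/bD/bm1_bm.
  by move=> x; exact: nrm_norm.
rewrite (E _ (pal n)) (E _ pbe).
have G : \sum_(b : {ffun 'I_m -> bool}) al n (Q (cell b)) * mean L b f -
    \sum_(b : {ffun 'I_m -> bool}) be (Q (cell b)) * mean L b f <=
    \sum_(b : {ffun 'I_m -> bool}) `|al n (Q (cell b)) - be (Q (cell b))|.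
  rewrite -sumrB; apply: ler_sum => b _; rewrite -mulrBl.
  by rewrite (le_trans (ler_norm _))// normrM ler_piMr// mean_le1.
move: (F _ (pal n)) (F _ pbe); rewrite !ler_norml => /andP[? ?] /andP[? ?]; lra.
Qed.

End Rank.

(** * Asymptotic norm and the zero-two law *)

Section Asymptotic.
Context d (Y : measurableType d) (R : realType).
Implicit Types (s r t e : R) (f g : Y -> R) (S L : (Y -> R) -> R) (B N : set Y).

Record markov_sg (Q : R -> (Y -> R) -> Y -> R) : Prop := MarkovSg {
  msg_mk : forall t, 0 <= t -> markov_op (Q t) ;
  msgD : forall s t, 0 <= s -> 0 <= t -> forall f, bm f ->
    Q (s + t) f = Q s (Q t f) ;
  msg0 : forall f, bm f -> Q 0 f = f }.

Variable Q : R -> (Y -> R) -> Y -> R.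
Hypothesis hQ : markov_sg Q.

Let mQ t (t0 : 0 <= t) := msg_mk hQ t0.

Lemma bmQ t f : 0 <= t -> bm f -> bm (Q t f).
Proof. by move=> t0; apply: mk_bm; exact: mQ. Qed.

Lemma bm1Q t f : 0 <= t -> bm1 f -> bm1 (Q t f).
Proof. by move=> t0; apply: mk_bm1; exact: mQ. Qed.

Lemma QC s t f : 0 <= s -> 0 <= t -> bm f -> Q s (Q t f) = Q t (Q s f).
Proof. by move=> s0 t0 bf; rewrite -!(msgD hQ)// addrC. Qed.

Lemma signedQ t S : 0 <= t -> signed S -> signed (fun f => S (Q t f)).
Proof. by move=> t0; apply: signed_markov; exact: mQ. Qed.

Lemma posQ t L : 0 <= t -> pos L -> pos (fun f => L (Q t f)).
Proof. by move=> t0; apply: pos_markov; exact: mQ. Qed.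

Lemma Q1 t : 0 <= t -> Q t (fun=> 1) = fun=> 1.
Proof. by move=> t0; exact/mk_one/mQ. Qed.

Lemma pos_eval (x : Y) : pos (fun f : Y -> R => f x).
Proof. by split; [split => // F f []|]. Qed.

(* The infimum is lim_n nrm (S Q_n), as these norms decrease. *)
Definition asym S : R := inf (range (fun n : nat => nrm (fun f => S (Q n%:R f)))).

Lemma nrmQ t S : 0 <= t -> signed S -> nrm (fun f => S (Q t f)) <= nrm S.
Proof. by move=> t0 sS; apply: nrm_le => f bf; apply: nrm_ub => //; exact: bm1Q. Qed.

Lemma nrmQ_dec r t S : 0 <= r -> r <= t -> signed S ->
  nrm (fun f => S (Q t f)) <= nrm (fun f => S (Q r f)).
Proof.
move=> r0 rt sS; have tr : 0 <= t - r by rewrite subr_ge0.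
apply: (le_trans _ (nrmQ tr (signedQ r0 sS))).
rewrite le_eqVlt; apply/orP; left; apply/eqP; apply: eq_nrm => f bf.
by rewrite -(msgD hQ)//; [rewrite subrKC|exact: bm1_bm].
Qed.

Let asym_lb S : signed S ->
  has_lbound (range (fun n : nat => nrm (fun f => S (Q n%:R f)))).
Proof. by move=> sS; exists 0 => _ [n _ <-]; apply/nrm_ge0/signedQ. Qed.

Lemma asym_cvg S : signed S ->
  nrm (fun f => S (Q n%:R f)) @[n --> \oo] --> asym S.
Proof.
move=> sS; apply: nonincreasing_cvgn; last exact: asym_lb.
by move=> m n mn; apply: nrmQ_dec => //; rewrite ler_nat.
Qed.

Lemma asym_ge0 S : signed S -> 0 <= asym S.
Proof.
move=> sS; apply: lb_le_inf; first by exists (nrm (fun f => S (Q 0%:R f))), 0%N.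
by move=> _ [n _ <-]; apply/nrm_ge0/signedQ.
Qed.

(** Norms decrease along the semigroup, so a real time may be rounded up to an integer. *)
Lemma asym_le_nrmQ r S : 0 <= r -> signed S -> asym S <= nrm (fun f => S (Q r f)).
Proof.
move=> r0 sS; apply: (@le_trans _ _ (nrm (fun f => S (Q (Num.trunc r).+1%:R f)))).
  by apply: ge_inf; [exact: asym_lb|exists (Num.trunc r).+1].
by apply: nrmQ_dec => //; rewrite ltW// truncnS_gt.
Qed.

Lemma asym_le_nrm S : signed S -> asym S <= nrm S.
Proof.
move=> sS; apply: (le_trans (asym_le_nrmQ (lexx 0) sS)).
exact: nrmQ.
Qed.

Lemma asym_near S (e : R) : signed S -> 0 < e ->
  exists n : nat, nrm (fun f => S (Q n%:R f)) <= asym S + e.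
Proof.
move=> sS e0; have /cvgrPdist_le/(_ _ e0)[n _ /(_ n (leqnn n))] := asym_cvg sS.
by rewrite ler_norml => /andP[h _]; exists n; lra.
Qed.

Lemma asym_le S (c : R) : signed S ->
  (forall e : R, 0 < e -> exists2 r, 0 <= r & nrm (fun f => S (Q r f)) <= c + e) ->
  asym S <= c.
Proof.
move=> sS h; apply/ler_addgt0Pr => e /h[r r0].
by apply: le_trans; exact: asym_le_nrmQ.
Qed.

Lemma eq_asym S1 S2 : (forall f, bm f -> S1 f = S2 f) -> asym S1 = asym S2.
Proof.
move=> h; rewrite /asym; congr inf; apply/seteqP.
have e n : nrm (fun f => S1 (Q n%:R f)) = nrm (fun f => S2 (Q n%:R f)).
  by apply: eq_nrm => f bf; apply: h; apply: bmQ => //; exact: bm1_bm.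
by split => _ [n _ <-]; exists n.
Qed.

(** Waiting a time r only shifts the decreasing family of norms; a measure may thus be smoothed
    before it is estimated. *)
Lemma asymQ r S : 0 <= r -> signed S -> asym (fun f => S (Q r f)) = asym S.
Proof.
move=> r0 sS; have sQ := signedQ r0 sS.
apply/eqP; rewrite eq_le; apply/andP; split; apply: asym_le => // e e0.
  have [n hn] := asym_near sS e0; exists n%:R => //; apply: le_trans hn.
  apply: (le_trans _ (nrmQ r0 (signedQ (ler0n _ n) sS))).
  rewrite le_eqVlt; apply/orP; left; apply/eqP; apply: eq_nrm => f bf.
  by rewrite QC//; exact: bm1_bm.
have [n hn] := asym_near sQ e0; exists (r + n%:R); first by rewrite addr_ge0.
apply: le_trans hn.
rewrite le_eqVlt; apply/orP; left; apply/eqP; apply: eq_nrm => f bf.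
by rewrite (msgD hQ)//; exact: bm1_bm.
Qed.

Lemma asymD S1 S2 : signed S1 -> signed S2 ->
  asym (fun f => S1 f + S2 f) <= asym S1 + asym S2.
Proof.
move=> s1 s2; have s12 : signed (fun f => S1 f + S2 f).
  by move: (signed_lin 1 s1 s2); congr signed; apply/funext => f; rewrite mul1r.
apply: asym_le => // e e0; have e2 : 0 < e / 2 by rewrite divr_gt0.
have [n hn] := asym_near s1 e2; have [m hm] := asym_near s2 e2.
exists (maxn n m)%:R => //.
apply: (le_trans (nrmD (signedQ (ler0n _ _) s1) (signedQ (ler0n _ _) s2))).
have : nrm (fun f => S1 (Q (maxn n m)%:R f)) <= nrm (fun f => S1 (Q n%:R f)).
  by apply: nrmQ_dec => //; rewrite ler_nat leq_maxl.
have : nrm (fun f => S2 (Q (maxn n m)%:R f)) <= nrm (fun f => S2 (Q m%:R f)).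
  by apply: nrmQ_dec => //; rewrite ler_nat leq_maxr.
lra.
Qed.

Lemma asymZ (a : R) S : 0 <= a -> signed S -> asym (fun f => a * S f) <= a * asym S.
Proof.
move=> a0 sS; have saS : signed (fun f => a * S f).
  by move: (signed_lin a sS (@signed0 _ Y R)); congr signed; apply/funext => f; rewrite addr0.
apply: asym_le => // e e0.
have e1 : 0 < e / (a + 1) by rewrite divr_gt0// ltr_wpDl.
have [n hn] := asym_near sS e1; exists n%:R => //.
have h : nrm (fun f => a * S (Q n%:R f)) <= a * nrm (fun f => S (Q n%:R f)).
  apply: nrm_le => f bf; rewrite ler_wpM2l//.
  exact: (nrm_ub (signedQ (ler0n _ n) sS)).
apply: (le_trans h); apply: (le_trans (ler_wpM2l a0 hn)).
rewrite mulrDr lerD2l mulrCA ler_piMr ?(ltW e0)//.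
by rewrite ler_pdivrMr ?mul1r ?ltr_wpDl// lerDl.
Qed.

(** In terms of measures, S - T(s) S. *)
Definition incr s S f : R := S f - S (Q s f).

Lemma signed_incr s S : 0 <= s -> signed S -> signed (incr s S).
Proof. by move=> s0 sS; apply: signedB => //; exact: signedQ. Qed.

Lemma incr_le2 s L : 0 <= s -> pos L -> nrm (incr s L) <= 2 * L (fun=> 1).
Proof.
move=> s0 pL; apply: nrm_le => f bf; rewrite /incr.
have h1 := nrm_norm pL.1 bf; have h2 := nrm_norm pL.1 (bm1Q s0 bf).
have h3 := nrm_pos pL.
by move: h1 h2; rewrite !ler_norml => /andP[? ?] /andP[? ?]; lra.
Qed.

Lemma asym_incr_le2 s L : 0 <= s -> pos L -> asym (incr s L) <= 2 * L (fun=> 1).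
Proof.
move=> s0 pL; apply: le_trans (incr_le2 s0 pL).
by apply: asym_le_nrm; apply: signed_incr => //; exact: pL.1.
Qed.

Section osc.
Variable U : nat -> set Y.
Hypothesis gU : generates U.

Definition osc s (x : Y) : R := asym (incr s (fun f => f x)).

Let oscn s (n : nat) (x : Y) : R := nrm (fun f => incr s (fun f => f x) (Q n%:R f)).

Let oscn_bound s n x : 0 <= s -> 0 <= oscn s n x <= 2.
Proof.
move=> s0; have sx := signed_incr s0 (pos_eval x).1.
rewrite nrm_ge0/=; last exact: signedQ.
apply: (le_trans (nrmQ (ler0n _ n) sx)).
by rewrite (le_trans (incr_le2 s0 (pos_eval x)))// mulr1.
Qed.

Let bcvg_osc s : 0 <= s -> bcvg (oscn s) (osc s).
Proof.
move=> s0; split.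
- move=> n; apply: (measurable_nrm gU) => [x|f bf].
    by apply: signedQ => //; apply: signed_incr => //; exact: (pos_eval x).1.
  rewrite /incr; apply: measurable_funB.
    by case: (bmQ (ler0n _ n) bf).
  by case: (bmQ s0 (bmQ (ler0n _ n) bf)).
- by exists 2 => n x; have /andP[? ?] := oscn_bound n x s0; rewrite ger0_norm.
- by move=> x; apply: asym_cvg; apply: signed_incr => //; exact: (pos_eval x).1.
Qed.

Lemma bm_osc s : 0 <= s -> bm (osc s).
Proof. by move=> s0; exact/bm_cvg/bcvg_osc. Qed.

Lemma osc_ge0 s x : 0 <= s -> 0 <= osc s x.
Proof. by move=> s0; apply: asym_ge0; apply: signed_incr => //; exact: (pos_eval x).1. Qed.

(** For fixed n, the value at a test function is the L-integral of its values at point masses, each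
    at most the norm there. The inequality survives n -> oo by bounded convergence. *)
Lemma asym_incr_le s L : 0 <= s -> pos L -> asym (incr s L) <= L (osc s).
Proof.
move=> s0 pL; have c := sg_cts pL.1 (bcvg_osc s0).
have c' := asym_cvg (signed_incr s0 pL.1).
rewrite -(cvg_lim _ c)// -(cvg_lim _ c')//.
apply: ler_lim; [exact: cvgP c'|exact: cvgP c|].
apply: nearW => n; apply: nrm_le => f bf.
have bQf := bmQ (ler0n _ n) (bm1_bm bf).
rewrite /incr -(sgB pL.1)//; last exact: bmQ.
apply: (pos_le pL).
- by apply: bmB => //; exact: bmQ.
- by split; [case: (bcvg_osc s0)|exists 2 => x; have /andP[? ?] := oscn_bound n x s0; rewrite ger0_norm].
- move=> x; apply: (nrm_ub (S := fun f => incr s (fun f => f x) (Q n%:R f))) => //.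
  by apply: signedQ => //; apply: signed_incr => //; exact: (pos_eval x).1.
Qed.

(** By [asymQ] the point mass may be replaced by its law at time r, for which the asymptotic norm of
    the increment is at most the average of [osc s]. This subharmonicity is what makes sublevel sets
    of [osc s] absorbing. *)
Lemma osc_sub s r x : 0 <= s -> 0 <= r -> osc s x <= Q r (osc s) x.
Proof.
move=> s0 r0; have px := pos_eval x.
rewrite /osc -(asymQ r0 (signed_incr s0 px.1)).
have -> : asym (fun f => incr s (fun f => f x) (Q r f)) =
    asym (incr s (fun f => Q r f x)).
  by apply: eq_asym => f bf; rewrite /incr QC.
exact: (asym_incr_le s0 (posQ r0 px)).
Qed.

End osc.

(** In a convex sequence one positive increment persists and gives linear growth, against the bound
    c; so v is nonincreasing from v 0 = 0. *)
Lemma convex_bounded (v : nat -> R) (c : R) : v 0%N = 0 ->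
  (forall j, v j <= c) -> (forall j, 2 * v j.+1 <= v j + v j.+2) ->
  forall j, v j <= 0.
Proof.
move=> v0 vc vv.
have D k : v k.+1 <= v k.
  rewrite leNgt; apply/negP => h; pose e := v k.+1 - v k.
  have e0 : 0 < e by rewrite subr_gt0.
  have grow n : e <= v (n + k).+1 - v (n + k)%N.
    elim: n => [|n IH]; first by rewrite add0n.
    by have := vv (n + k)%N; rewrite addSn; move: IH; lra.
  have lin n : n%:R * e <= v (n + k)%N - v k.
    elim: n => [|n IH]; first by rewrite mul0r add0n subrr.
    by rewrite -natr1 addSn; have := grow n; lra.
  pose n := (Num.trunc ((c - v k) / e)).+1.
  have : (c - v k) / e < n%:R by exact: truncnS_gt.
  rewrite ltr_pdivrMr//; have := lin n; have := vc (n + k)%N; lra.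
elim=> [|j IH]; first by rewrite v0.
exact: le_trans (D j) IH.
Qed.

Section zero_two.
Variables (rho : (Y -> R) -> R) (prho : pos rho).

Lemma dominated_fun L : pos L -> dominated rho L ->
  forall g, bm g -> (forall x, 0 <= g x) -> rho g = 0 -> L g = 0.
Proof.
move=> pL dL g bg g0 rg.
have [mN rN] := pos_null_support prho bg g0 rg.
have LN := dL _ mN rN; set N := [set x | 0 < g x] in LN mN.
have [M gM] := bg.2.
apply/eqP; rewrite eq_le; apply/andP; split; last exact: pL.2.
rewrite -[leRHS](mulr0 M) -LN -(sgZ pL.1); last exact: bm_indic.
apply: (pos_le pL) => //; first exact/bmZ/bm_indic.
move=> x; rewrite indicE; case: (boolP (x \in N)) => [|] h.
  by rewrite mulr1 (le_trans (ler_norm _)).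
by rewrite mulr0 leNgt; move: h; rewrite notin_setE => /negP.
Qed.

Hypothesis subinv : forall r N, 0 <= r -> measurable N -> rho \1_N = 0 ->
  rho (Q r \1_N) = 0.

Definition acont L : Prop := pos L /\ dominated rho L.

(** [rho] will be an invariant measure cut to an absorbing set. By [subinv], rho-almost every point
    gives a rho-null set no mass at time r, and L inherits this. *)
Lemma acontQ r L : 0 <= r -> acont L -> acont (fun f => L (Q r f)).
Proof.
move=> r0 [pL dL]; split; first exact: posQ.
move=> N mN rN; apply: (dominated_fun pL dL).
- by apply: bmQ => //; exact: bm_indic.
- move=> x; apply: (mk_pos (mQ r0) x).2; first exact: bm_indic.
  by move=> y; exact: indic_ge0.
- exact: subinv.
Qed.

Lemma acont_restr L k : bm k -> (forall x, 0 <= k x) -> acont L ->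
  acont (fun f => L (fun x => k x * f x)).
Proof.
move=> bk k0 [pL dL]; split; first exact: pos_restr.
move=> N mN rN; have [M kM] := bk.2.
have bN : bm (\1_N : Y -> R) by exact: bm_indic.
apply/eqP; rewrite eq_le; apply/andP; split.
  rewrite -[leRHS](mulr0 M) -(dL _ mN rN) -(sgZ pL.1)//.
  apply: (pos_le pL); [exact: bmM|exact: bmZ|].
  by move=> x; rewrite ler_wpM2r ?indic_ge0// (le_trans (ler_norm _)).
by apply: pL.2; [exact: bmM|move=> x; rewrite mulr_ge0// indic_ge0].
Qed.

Lemma acontD L1 L2 : acont L1 -> acont L2 -> acont (fun f => L1 f + L2 f).
Proof.
move=> [p1 d1] [p2 d2]; split; first exact: posD.
by move=> N mN rN; rewrite d1// d2// addr0.
Qed.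

Lemma acontZ (a : R) L : 0 <= a -> acont L -> acont (fun f => a * L f).
Proof.
move=> a0 [pL dL]; split; first exact: posZ.
by move=> N mN rN; rewrite dL// mulr0.
Qed.

Variable s : R.
Hypothesis s0 : 0 <= s.
Hypothesis half : forall L, acont L -> asym (incr s L) <= L (fun=> 1).

(* The common part U of L Q_n and L Q_(n+s) carries at least a quarter of the
   mass; regrouping, L Q_(n+s) = (U + U Q_s) / 2 + (R2 + R1 Q_s) / 2. *)
Lemma common_part L : acont L -> exists (n : nat) (U R1 R2 : (Y -> R) -> R),
  [/\ [/\ acont U, acont R1 & acont R2],
      forall f, bm f -> L (Q n%:R f) = U f + R1 f,
      forall f, bm f -> L (Q n%:R (Q s f)) = U f + R2 f,
      R1 (fun=> 1) = R2 (fun=> 1) & L (fun=> 1) <= 4 * U (fun=> 1)].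
Proof.
move=> aL; have [pL dL] := aL.
(* [half] bounds the limit of the norms by L(1); the slack L(1) / 2 up to 3/2 must be positive, so
   zero mass is treated apart. *)
have [n hn] : exists n : nat,
    nrm (fun f => incr s L (Q n%:R f)) <= 3 / 2 * L (fun=> 1).
  have [L0|L0] := eqVneq (L (fun=> 1)) 0.
    exists 0%N; rewrite L0 mulr0.
    have := incr_le2 s0 pL; rewrite L0 mulr0; apply: le_trans.
    by apply: nrmQ => //; apply: signed_incr => //; exact: pL.1.
  have {}L0 : 0 < L (fun=> 1) by rewrite lt_neqAle eq_sym L0 pos1_ge0.
  have e0 : 0 < L (fun=> 1) / 2 by rewrite divr_gt0.
  have [n hn] := asym_near (signed_incr s0 pL.1) e0; exists n.
  by have := half aL; lra.
pose L' f := L (Q n%:R f); pose L'' f := L' (Q s f).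
have aL' : acont L' by exact: acontQ.
have aL'' : acont L'' by exact: acontQ.
have sS : signed (fun f => L' f - L'' f).
  by apply: signedB; [exact: aL'.1.1|exact: aL''.1.1].
have [P mP [h1 h2]] := signed_hahn sS.
have bP : bm (\1_P : Y -> R) by exact: bm_indic.
have bC : bm (\1_(~` P) : Y -> R) by exact/bm_indic/measurableC.
have spl (M : (Y -> R) -> R) f : signed M -> bm f ->
    M f = M (fun x => \1_P x * f x) + M (fun x => \1_(~` P) x * f x).
  move=> sM bf; rewrite -(sgD sM); [|exact: bmM..].
  by congr M; apply/funext => x; rewrite indic_setC; ring.
have sub (M1 M2 : (Y -> R) -> R) : signed M1 -> acont M2 ->
    (forall f, bm f -> (forall x, 0 <= f x) -> 0 <= M1 f <= M2 f) -> acont M1.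
  move=> s1 [p2 d2] h; split; first by split => // f bf f0; have /andP[] := h f bf f0.
  move=> N mN rN; have bN : bm (\1_N : Y -> R) by exact: bm_indic.
  have /andP[i1 i2] := h _ bN (@indic_ge0 _ Y R N).
  by apply/eqP; rewrite eq_le i1 andbT -(d2 _ mN rN).
(* P is a Hahn set of L' - L'', so U is the minimum of the two: L'' on P, where it is the smaller,
   and L' elsewhere. R1 and R2 are what remains of L' and L''. *)
pose U f := L'' (fun x => \1_P x * f x) + L' (fun x => \1_(~` P) x * f x).
pose R1 f := L' (fun x => \1_P x * f x) - L'' (fun x => \1_P x * f x).
pose R2 f := L'' (fun x => \1_(~` P) x * f x) - L' (fun x => \1_(~` P) x * f x).
have i0 A x : 0 <= (\1_A x : R) := @indic_ge0 _ Y R A x.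
have aU : acont U by apply: acontD; exact: acont_restr.
have aR1 : acont R1.
  apply: (sub _ _ _ (acont_restr bP (i0 P) aL')).
    by apply: signedB; apply: signed_restr => //; [exact: aL'.1.1|exact: aL''.1.1].
  move=> f bf f0; rewrite h1//= /R1 gerBl.
  by apply: aL''.1.2; [exact: bmM|move=> x; rewrite mulr_ge0].
have aR2 : acont R2.
  apply: (sub _ _ _ (acont_restr bC (i0 _) aL'')).
    by apply: signedB; apply: signed_restr => //; [exact: aL''.1.1|exact: aL'.1.1].
  move=> f bf f0; have := h2 f bf f0; rewrite /R2 subr_le0 subr_ge0 => -> /=.
  by rewrite gerBl; apply: aL'.1.2; [exact: bmM|move=> x; rewrite mulr_ge0].
have b1 := bm_cst Y (1 : R).
have m1 : L' (fun=> 1) = L (fun=> 1) by rewrite /L' Q1.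
have m2 : L'' (fun=> 1) = L (fun=> 1) by rewrite /L'' Q1// m1.
have t1 := spl _ _ aL'.1.1 b1; have t2 := spl _ _ aL''.1.1 b1.
exists n, U, R1, R2; split => //.
- by move=> f bf; rewrite -/(L' f) /U /R1 (spl _ _ aL'.1.1 bf); ring.
- rewrite /U /R2 => f bf.
  have -> : L (Q n%:R (Q s f)) = L'' f by [].
  by rewrite (spl _ _ aL''.1.1 bf); ring.
- by rewrite /R1 /R2; lra.
(* At [polar P] the difference takes the value 2 L(1) - 2 U(1); as this is at most 3/2 L(1), U has
   at least a quarter of the mass. *)
have := nrm_ub sS (bm1_polar R mP).
have -> : nrm (fun f => L' f - L'' f) = nrm (fun f => incr s L (Q n%:R f)).
  by apply: eq_nrm => f bf; rewrite /incr QC//; exact: bm1_bm.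
have pe (M : (Y -> R) -> R) : signed M -> M (polar P) =
    M (fun x => \1_P x * 1) - M (fun x => \1_(~` P) x * 1).
  move=> sM; rewrite -(sgB sM); [|exact: bmM..].
  by congr M; apply/funext => x; rewrite /polar !mulr1.
rewrite (pe _ aL'.1.1) (pe _ aL''.1.1) /U.
by move: hn t1 t2; rewrite m1 m2; lra.
Qed.

Let v j : R := sup [set asym (incr (j%:R * s) L) | L in
  [set L | acont L /\ L (fun=> 1) <= 1]].

Let js0 j : 0 <= j%:R * s. Proof. by rewrite mulr_ge0. Qed.

Let v_ub j : has_ubound [set asym (incr (j%:R * s) L) | L in
  [set L | acont L /\ L (fun=> 1) <= 1]].
Proof.
exists 2 => _ [L [[pL dL] L1] <-].
by rewrite (le_trans (asym_incr_le2 (js0 j) pL))//; lra.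
Qed.

Let acont0 : acont (fun=> 0).
Proof. by split => //; split => //; exact: signed0. Qed.

Let v_le2 j : v j <= 2.
Proof.
apply: ge_sup.
  by exists (asym (incr (j%:R * s) (fun=> 0))), (fun=> 0); split.
move=> _ [L [[pL dL] L1] <-].
by rewrite (le_trans (asym_incr_le2 (js0 j) pL))//; lra.
Qed.

Let v_le j (c : R) : (forall L, acont L -> L (fun=> 1) <= 1 ->
  asym (incr (j%:R * s) L) <= c) -> v j <= c.
Proof.
move=> h; apply: ge_sup; last by move=> _ [L [aL L1] <-]; exact: h.
by exists (asym (incr (j%:R * s) (fun=> 0))), (fun=> 0); split.
Qed.

Let v_asym j L : acont L -> asym (incr (j%:R * s) L) <= L (fun=> 1) * v j.
Proof.
move=> aL; have [pL dL] := aL.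
have [L0|L0] := eqVneq (L (fun=> 1)) 0.
  by have := asym_incr_le2 (js0 j) pL; rewrite L0 mulr0 mul0r.
have {}L0 : 0 < L (fun=> 1) by rewrite lt_neqAle eq_sym L0 pos1_ge0.
pose M f := (L (fun=> 1))^-1 * L f.
have aM : acont M by apply: acontZ => //; rewrite invr_ge0 ltW.
have -> : asym (incr (j%:R * s) L) =
    asym (fun f => L (fun=> 1) * incr (j%:R * s) M f).
  apply: eq_asym => f bf; rewrite /incr /M -mulrBr mulrA divff ?mul1r//.
  exact: lt0r_neq0.
apply: (le_trans (asymZ (ltW L0) (signed_incr (js0 j) aM.1.1))).
rewrite ler_pM2l//; apply: ub_le_sup; first exact: v_ub.
by exists M => //; split => //; rewrite /M mulVf// lt0r_neq0.
Qed.

Let v_ge0 j : 0 <= v j.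
Proof.
apply: le_trans; first exact: (asym_ge0 (signed_incr (js0 j) (@signed0 _ Y R))).
by apply: ub_le_sup; [exact: v_ub|exists (fun=> 0)].
Qed.

Lemma zero_two j L : acont L -> asym (incr (j%:R * s) L) = 0.
Proof.
move=> aL; apply/eqP; rewrite eq_le; apply/andP; split; last first.
  by apply: asym_ge0; apply: signed_incr; [exact: js0|exact: aL.1.1].
suff h i : v i <= 0.
  apply: (le_trans (v_asym j aL)).
  by rewrite mulr_ge0_le0// pos1_ge0//; exact: aL.1.
apply: (@convex_bounded v 2) => // {L aL i}.
- apply/eqP; rewrite eq_le; apply/andP; split.
    apply: v_le => L aL _.
    have -> : asym (incr (0%:R * s) L) = asym (fun=> 0).
      by apply: eq_asym => f bf; rewrite /incr mul0r (msg0 hQ)// subrr.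
    apply: (le_trans (asym_le_nrm (@signed0 _ Y R))).
    by apply: nrm_le => f bf.
  apply: le_trans; first exact: (asym_ge0 (signed_incr (js0 0) (@signed0 _ Y R))).
  by apply: ub_le_sup; [exact: v_ub|exists (fun=> 0)].
move=> i; rewrite leNgt; apply/negP => hlt.
(* If convexity failed at i, c would lie below v i.+1, and the common part, of mass at least L(1) /
   4, would pull the supremum v i.+1 below itself by a quarter of the gap. *)
pose c := (v i + v i.+2) / 2.
have cv : c < v i.+1 by rewrite /c; lra.
have : v i.+1 <= v i.+1 - (v i.+1 - c) / 4; last by lra.
apply: v_le => L aL L1.
have [n [U [R1 [R2 [[aU aR1 aR2] e1 e2 m12 mU]]]]] := common_part aL.
have m1 : L (fun=> 1) = U (fun=> 1) + R1 (fun=> 1).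
  by rewrite -e1 ?Q1//; exact: bm_cst.
pose t := i.+1%:R * s; have t0 : 0 <= t by exact: js0.
have ns0 : 0 <= n%:R + s by rewrite addr_ge0.
have sg (M : (Y -> R) -> R) r : 0 <= r -> acont M -> signed (incr r M).
  by move=> r0 [[sM _] _]; exact: signed_incr.
have aUs : acont (fun f => U (Q s f)) by exact: acontQ.
have aRs : acont (fun f => R1 (Q s f)) by exact: acontQ.
rewrite -/t -(asymQ ns0 (sg _ _ t0 aL)).
(* The common part is paired crosswise: U with its image at time (i+2) s, and U Q_s with its own
   image after i s. These four terms are exactly those of the increment of U + U Q_s by t = (i+1)
   s. *)
have -> : asym (fun f => incr t L (Q (n%:R + s) f)) =
  asym (fun f => 2^-1 * ((incr (i.+2%:R * s) U f + incr (i%:R * s) (fun f => U (Q s f)) f) +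
    (incr t R2 f + incr t (fun f => R1 (Q s f)) f))).
  apply: eq_asym => f bf; rewrite /incr.
  have E g : bm g -> L (Q (n%:R + s) g) =
      2^-1 * ((U g + U (Q s g)) + (R2 g + R1 (Q s g))).
    move=> bg; rewrite (msgD hQ)//.
    have := e2 g bg; have := e1 (Q s g) (bmQ s0 bg); lra.
  rewrite QC// E// E; last exact: bmQ.
  have -> : Q s (Q t f) = Q (i.+2%:R * s) f.
    by rewrite -(msgD hQ)//; congr (Q _ f); rewrite /t -[i.+2%:R]natr1; ring.
  have -> : Q t f = Q s (Q (i%:R * s) f).
    by rewrite -(msgD hQ)//; congr (Q _ f); rewrite /t -[i.+1%:R]natr1; ring.
  ring.
have sU1 := sg _ _ (js0 i.+2) aU; have sU2 := sg _ _ (js0 i) aUs.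
have sR2 := sg _ _ t0 aR2; have sR1 := sg _ _ t0 aRs.
have sD (M1 M2 : (Y -> R) -> R) : signed M1 -> signed M2 -> signed (fun f => M1 f + M2 f).
  by move=> h1 h2; move: (signed_lin 1 h1 h2); congr signed; apply/funext => f; rewrite mul1r.
have i2 : 0 <= 2^-1 :> R by rewrite invr_ge0.
apply: (le_trans (asymZ i2 (sD _ _ (sD _ _ sU1 sU2) (sD _ _ sR2 sR1)))).
have a1 := asymD (sD _ _ sU1 sU2) (sD _ _ sR2 sR1).
have a2 := asymD sU1 sU2; have a3 := asymD sR2 sR1.
have b1 := v_asym i.+2 aU; have b2 := v_asym i aUs.
have b3 := v_asym i.+1 aR2; have b4 := v_asym i.+1 aRs.
rewrite Q1// in b2; rewrite Q1// -/t in b4; rewrite -/t -m12 in b3.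
have bound : 2^-1 * asym (fun f => (incr (i.+2%:R * s) U f +
   incr (i%:R * s) (fun f => U (Q s f)) f) +
    (incr t R2 f + incr t (fun f => R1 (Q s f)) f)) <=
   U (fun=> 1) * c + R1 (fun=> 1) * v i.+1.
  by rewrite /c; lra.
apply: (le_trans bound).
have vc : 0 < v i.+1 - c by rewrite subr_gt0.
have -> : R1 (fun=> 1) = L (fun=> 1) - U (fun=> 1) by rewrite m1; ring.
(* The gap to be shown nonnegative is the sum of two products: [q1] uses L(1) <= 1, and [q2] the
   quarter from [common_part]. *)
have q1 : 0 <= (1 - L (fun=> 1)) * (v i.+1 - (v i.+1 - c) / 4).
  apply: mulr_ge0; first by rewrite subr_ge0.
  by have := v_ge0 i.+1; have := v_ge0 i; have := v_ge0 i.+2; rewrite /c; lra.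
have q2 : 0 <= (U (fun=> 1) - L (fun=> 1) / 4) * (v i.+1 - c).
  by apply: mulr_ge0; [lra|exact: ltW].
rewrite -subr_ge0; apply: le_trans (addr_ge0 q1 q2) _.
by rewrite le_eqVlt; apply/orP; left; apply/eqP; field.
Qed.

End zero_two.

End Asymptotic.

(** * Semigroups with an invariant measure *)

Section Invariant.
Context d (Y : measurableType d) (R : realType).
Implicit Types (s r t e : R) (f g : Y -> R) (S L : (Y -> R) -> R) (B N : set Y).

(* W collects the points from which Q charges the singular part of La. *)
Lemma absolutely_continuous_off (Q : (Y -> R) -> Y -> R) (La p : (Y -> R) -> R) :
  markov_op Q -> pos La -> pos p ->
  (forall x, dominated La (fun f => Q f x)) ->
  (forall f, bm f -> p (Q f) = p f) ->
  exists W : set Y, [/\ measurable W, p \1_W = 0 &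
    forall x, ~ W x -> dominated p (fun f => Q f x)].
Proof.
move=> kQ pLa pp domL inv.
have /choice[H hH] : forall k : nat, exists Hk : set Y, [/\ measurable Hk,
   forall f, bm f -> (forall x, 0 <= f x) ->
     La (fun x => \1_Hk x * f x) <= k%:R * p (fun x => \1_Hk x * f x) &
   forall f, bm f -> (forall x, 0 <= f x) ->
     k%:R * p (fun x => \1_(~` Hk) x * f x) <= La (fun x => \1_(~` Hk) x * f x)].
  move=> k.
  have sS := signed_lin k%:R pp.1 (signedN pLa.1).
  have [P mP [h1 h2]] := signed_hahn sS; exists P; split => // f bf f0.
    by have := h1 f bf f0; rewrite subr_ge0.
  by have := h2 f bf f0; rewrite subr_le0.
have mH k : measurable (H k) by case: (hH k).
(* Lebesgue decomposition: La <= k p on [H k], so La is absolutely continuous with respect to p on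
   [Z], while k p <= La off every [H k] forces p to vanish off [Z]. *)
pose Z := \bigcup_k H k.
have mZ : measurable Z by exact: bigcup_measurable.
have mCZ := measurableC mZ.
have bCZ : bm (\1_(~` Z) : Y -> R) by exact: bm_indic.
have pZ : p \1_(~` Z) = 0.
  apply/eqP; rewrite eq_le; apply/andP; split; last first.
    by apply: pp.2 => // x; exact: indic_ge0.
  have h k : k%:R * p \1_(~` Z) <= La (\1_(~` Z)).
    have [_ _ j] := hH k; have := j _ bCZ (@indic_ge0 _ Y R (~` Z)).
    have -> // : (fun x => \1_(~` H k) x * \1_(~` Z) x) = \1_(~` Z) :> (Y -> R).
    apply/funext => x; rewrite -indic_setI setIidr// => y; apply: contra_not => Hy.
    by exists k.
  rewrite leNgt; apply/negP => p0.
  have := h (Num.trunc (La \1_(~` Z) / p \1_(~` Z))).+1.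
  by rewrite leNgt -ltr_pdivrMr// truncnS_gt.
have Znull N : measurable N -> p \1_N = 0 -> La \1_(N `&` Z) = 0.
  move=> mN pN; rewrite setI_bigcupr; apply: pos_null_bigcup => // k.
    exact: measurableI.
  have bN : bm (\1_N : Y -> R) by exact: bm_indic.
  have bH : bm (\1_(H k) : Y -> R) by exact: bm_indic.
  have e : \1_(N `&` H k) = (fun x => \1_(H k) x * \1_N x) :> (Y -> R).
    by apply/funext => x; rewrite setIC indic_setI.
  apply/eqP; rewrite eq_le; apply/andP; split; last first.
    by apply: pLa.2; [apply: bm_indic; exact: measurableI|move=> x; exact: indic_ge0].
  rewrite e; have [_ j _] := hH k; have := j _ bN (@indic_ge0 _ Y R N).
  rewrite (pos_null_le pp _ bN _ pN) ?mulr0//; first exact: bmM.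
  by move=> x; rewrite mulr_ge0 ?indic_ge0//= ler_piMl ?indic_ge0 ?indic_le1.
have QZ0 x : 0 <= Q \1_(~` Z) x.
  by apply: (mk_pos kQ x).2 => // y; exact: indic_ge0.
(* By invariance p sees the complement of [Z] as little after applying Q as before, so the points
   from which Q charges that complement form a p-null set. *)
have [mW pW] : measurable [set x | 0 < Q \1_(~` Z) x] /\
    p \1_[set x | 0 < Q \1_(~` Z) x] = 0.
  by apply: pos_null_support => //; [exact: mk_bm|rewrite inv].
exists [set x | 0 < Q \1_(~` Z) x]; split => // x /= /negP.
rewrite -leNgt => Qx N mN pN.
have {}Qx : Q \1_(~` Z) x = 0 by apply/eqP; rewrite eq_le Qx QZ0.
have mNZ : measurable (N `&` Z) by exact: measurableI.
have bN : bm (\1_N : Y -> R) by exact: bm_indic.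
have bNZ : bm (\1_(N `&` Z) : Y -> R) by exact: bm_indic.
apply: (pos_null_le (g := fun y => \1_(N `&` Z) y + \1_(~` Z) y) (mk_pos kQ x)) => //.
- exact: bmD.
- move=> y; rewrite indic_ge0/= indic_setI indic_setC !indicE.
  case: (y \in N); case: (y \in Z) => /=; lra.
- by rewrite (sgD (mk_pos kQ x).1)// (domL x _ mNZ (Znull _ mN pN)) Qx addr0.
Qed.

Variable Q : R -> (Y -> R) -> Y -> R.
Hypothesis hQ : markov_sg Q.
Variable U : nat -> set Y.
Hypothesis gU : generates U.

Let kQ t (t0 : 0 <= t) : markov_op (Q t) := msg_mk hQ t0.

Lemma osc_le2 s x : 0 <= s -> osc Q s x <= 2.
Proof.
by move=> s0; rewrite (le_trans (asym_incr_le2 hQ s0 (pos_eval R x)))// mulr1.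
Qed.

Lemma asym_incrQ r s L : 0 <= r -> 0 <= s -> signed L ->
  asym Q (incr Q s (fun f => L (Q r f))) = asym Q (incr Q s L).
Proof.
move=> r0 s0 sL; rewrite -[RHS](asymQ hQ r0 (signed_incr hQ s0 sL)).
by apply: eq_asym hQ _ _ _ => f bf; rewrite /incr (QC hQ).
Qed.

Section invariant_measure.
Variables (p : (Y -> R) -> R) (pp : pos p).
Hypothesis inv : forall r f, 0 <= r -> bm f -> p (Q r f) = p f.

(** g = max(h - 1, 0) is again subharmonic, and p(Q r g - g) = 0 by invariance. On E, where g
    vanishes, [Q r g] is therefore 0 p-almost everywhere, so no mass passes from E to {g > 0}, its
    complement. *)
Lemma sublevel_absorbing r h : 0 <= r -> bm h -> (forall x, h x <= Q r h x) ->
  let E := [set x | h x <= 1] in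
  measurable E /\ p (fun x => \1_E x * Q r \1_(~` E) x) = 0.
Proof.
move=> r0 bh hh E.
have mE : measurable E.
  have -> : E = [set x | -1 <= -1 * h x].
    by apply/seteqP; split => x; rewrite /E/= mulN1r lerN2.
  by apply: measurable_level; case: bh.
split => //.
have bE : bm (\1_E : Y -> R) by exact: bm_indic.
pose g (x : Y) : R := Num.max (h x - 1) 0.
have b1 := bm_cst Y (1 : R).
have bg : bm g.
  split; first by apply: measurable_maxr; [case: (bmB bh b1)|exact: measurable_cst].
  have [M hM] := bh.2; exists (M + 1) => x; rewrite /g.
  have := hM x; rewrite ler_norml => /andP[h1 h2].
  have [h3|h3] := leP (h x - 1) 0; first by rewrite normr0; lra.
  by rewrite ger0_norm ?(ltW h3)//; lra.
have g0 x : 0 <= g x by rewrite /g le_max lexx orbT.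
have bQg : bm (Q r g) by exact: bmQ.
have Qg x : g x <= Q r g x.
  rewrite {1}/g ge_max; apply/andP; split; last exact: (mk_pos (kQ r0) x).2.
  apply: (@le_trans _ _ (Q r (fun y => h y - 1) x)).
    by rewrite (sgB (mk_pos (kQ r0) x).1)// (mk_one (kQ r0)) lerB.
  apply: (pos_le (mk_pos (kQ r0) x)) => //; first exact: bmB.
  by move=> y; rewrite /g le_max lexx.
pose L f := p (fun x => \1_E x * Q r f x).
have pL : pos L.
  exact: (pos_markov (kQ r0) (pos_restr pp bE (@indic_ge0 _ Y R E))).
have Lg : L g = 0.
  apply: (pos_null_le (g := fun x => Q r g x - g x) pp).
  - exact: bmM.
  - exact: bmB.
  - move=> x; apply/andP; split.
      by rewrite mulr_ge0 ?indic_ge0// (le_trans (g0 x)).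
    rewrite indicE; case: (boolP (x \in E)) => [|_]; last first.
      by rewrite mul0r subr_ge0.
    rewrite inE /E/= => hx; rewrite mul1r (_ : g x = 0) ?subr0//.
    by rewrite /g max_r// subr_le0.
  - by rewrite (sgB pp.1)// inv// subrr.
have [_] := pos_null_support pL bg g0 Lg.
rewrite (_ : [set x | 0 < g x] = ~` E)//.
apply/seteqP; split => x; rewrite /E/= /g.
  by rewrite lt_max ltxx orbF subr_gt0 => h1 h2; move: h1; rewrite ltNge h2.
by move/negP; rewrite -ltNge lt_max subr_gt0 => ->.
Qed.

Hypothesis osc0 : forall s x, 0 <= s ->
  osc Q (s / 2 ^+ n) x @[n --> \oo] --> (0 : R).

(* Zero-two law on E_n = {osc (s / 2^n) <= 1}, whose complement has small mass. *)
Lemma asym_incr_acont s L : 0 <= s -> pos L -> dominated p L ->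
  asym Q (incr Q s L) = 0.
Proof.
move=> s0 pL dL; have sL := pL.1.
apply/eqP; rewrite eq_le; apply/andP; split; last first.
  by apply: (asym_ge0 hQ); exact: (signed_incr hQ).
pose sn n : R := s / 2 ^+ n.
have sn0 n : 0 <= sn n by rewrite divr_ge0// exprn_ge0.
have bo n : bm (osc Q (sn n)) by exact: (bm_osc hQ gU).
have oo n r x : 0 <= r -> osc Q (sn n) x <= Q r (osc Q (sn n)) x.
  by move=> r0; exact: (osc_sub hQ gU).
pose E n := [set x | osc Q (sn n) x <= 1].
have mE n : measurable (E n) by case: (sublevel_absorbing (lexx 0) (bo n) (fun x => oo n 0 x (lexx 0))).
have bE n : bm (\1_(E n) : Y -> R) by exact: bm_indic.
have bCE n : bm (\1_(~` E n) : Y -> R) by exact/bm_indic/measurableC.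
have i0 A x : 0 <= (\1_A x : R) := @indic_ge0 _ Y R A x.
pose rho n f := p (fun x => \1_(E n) x * f x).
have prho n : pos (rho n) by exact: pos_restr.
(* The part of N in [E n] is p-null and stays so by invariance; the part outside is, by absorption,
   not reached from p-almost every point of [E n]. *)
have subinv n r N : 0 <= r -> measurable N -> rho n \1_N = 0 ->
    rho n (Q r \1_N) = 0.
  move=> r0 mN rN; have bN : bm (\1_N : Y -> R) by exact: bm_indic.
  have bEN : bm (fun x => \1_(E n) x * \1_N x : R) by exact: bmM.
  have [_ ab] := sublevel_absorbing r0 (bo n) (fun x => oo n r x r0).
  have Q0 f x : bm f -> (forall y, 0 <= f y) -> 0 <= Q r f x.
    by move=> bf f0; exact: (mk_pos (kQ r0) x).2.
  have bQ f : bm f -> bm (Q r f) by exact: bmQ.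
  apply: (pos_null_le (g := fun x => Q r (fun x => \1_(E n) x * \1_N x) x +
      \1_(E n) x * Q r \1_(~` E n) x) pp).
  - exact/bmM/bQ.
  - by apply: bmD; [exact: bQ|exact/bmM/bQ].
  - move=> x; rewrite mulr_ge0 ?Q0//=.
    have bs : bm (fun y => \1_(E n) y * \1_N y + \1_(~` E n) y : R) by exact: bmD.
    apply: (@le_trans _ _ (\1_(E n) x * Q r (fun y => \1_(E n) y * \1_N y +
        \1_(~` E n) y) x)).
      rewrite ler_wpM2l//; apply: (pos_le (mk_pos (kQ r0) x)) => // y.
      rewrite indic_setC !indicE; case: (_ \in _); case: (_ \in _) => /=; lra.
    rewrite (sgD (mk_pos (kQ r0) x).1)// mulrDr lerD2r ler_piMl ?indic_le1//.
    by apply: Q0 => // y; rewrite mulr_ge0.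
  - by rewrite (sgD pp.1) ?ab ?inv ?addr0//; [exact: bQ|exact/bmM/bQ].
(* osc is at most 1 on [E n] and at most 2 off it, on a set that M does not charge. *)
have half n M : acont (rho n) M -> asym Q (incr Q (sn n) M) <= M (fun=> 1).
  move=> [pM dM]; apply: (le_trans (asym_incr_le hQ gU (sn0 n) pM)).
  have MC : M \1_(~` E n) = 0.
    apply: dM; first exact: measurableC.
    rewrite /rho -[RHS](sg0 pp.1); congr p; apply/funext => x.
    by rewrite -indic_setI setICr indic0.
  have b1 := bm_cst Y (1 : R).
  apply: (@le_trans _ _ (M (fun x => 2 * \1_(~` E n) x + 1))).
    apply: (pos_le pM) => //; first by apply: bmD => //; exact: bmZ.
    move=> x; rewrite indic_setC indicE; case: (boolP (x \in E n)).
      by rewrite inE /E/= => h; rewrite subrr mulr0 add0r.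
    by move=> _; have := osc_le2 x (sn0 n); rewrite /= subr0; lra.
  by rewrite (sg_lin pM.1)// MC mulr0 add0r.
have zero n M : acont (rho n) M -> asym Q (incr Q s M) = 0.
  move=> aM; have := zero_two hQ (prho n) (subinv n) (sn0 n) (half n) (2 ^ n) aM.
  have -> // : (2 ^ n)%:R * sn n = s.
  by rewrite natrX /sn mulrC divfK// expf_neq0.
(* The part of L on [E n] contributes 0. Off [E n] one has osc >= 1, so the trivial bound by twice
   the mass there is at most 2 L(osc). *)
have key n : asym Q (incr Q s L) <= 2 * L (osc Q (sn n)).
  pose L1 f := L (fun x => \1_(E n) x * f x).
  pose L2 f := L (fun x => \1_(~` E n) x * f x).
  have p1 : pos L1 by exact: pos_restr.
  have p2 : pos L2 by exact: pos_restr.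
  have a1 : acont (rho n) L1.
    split => // N mN rN; have mEN : measurable (E n `&` N) by exact: measurableI.
    have e : (fun x => \1_(E n) x * \1_N x) = \1_(E n `&` N) :> (Y -> R).
      by apply/funext => x; rewrite indic_setI.
    by rewrite /L1 e; apply: dL => //; rewrite -e.
  have -> : asym Q (incr Q s L) = asym Q (fun f => incr Q s L1 f + incr Q s L2 f).
    apply: eq_asym hQ _ _ _ => f bf.
    have spl g : bm g -> L g = L1 g + L2 g.
      move=> bg; rewrite /L1 /L2 -(sgD sL); [|exact: bmM..].
      by congr L; apply/funext => x; rewrite indic_setC; ring.
    by rewrite /incr spl// [L (Q s f)]spl; [ring|exact: bmQ].
  apply: (le_trans (asymD hQ (signed_incr hQ s0 p1.1) (signed_incr hQ s0 p2.1))).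
  rewrite (zero _ _ a1) add0r (le_trans (asym_incr_le2 hQ s0 p2))// ler_wpM2l//.
  apply: (pos_le pL) => //; first by apply: bmM => //; exact: bm_cst.
  move=> x; rewrite mulr1 indic_setC indicE; case: (boolP (x \in E n)) => h.
    by rewrite subrr; exact: (osc_ge0 hQ).
  by rewrite /= subr0; move: h; rewrite notin_setE /E/= => /negP; rewrite -ltNge => /ltW.
have c : L (osc Q (sn n)) @[n --> \oo] --> (0 : R).
  rewrite -(sg0 sL); apply: (sg_cts sL); split.
  - by move=> n; case: (bo n).
  - by exists 2 => n x; rewrite ger0_norm ?osc_le2//; exact: (osc_ge0 hQ).
  - by move=> x; exact: osc0.
apply/ler_addgt0Pr => e e0; rewrite add0r.
have e2 : 0 < e / 2 by rewrite divr_gt0.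
have /cvgrPdist_le/(_ _ e2)[n _ /(_ n (leqnn n))] := c.
rewrite sub0r normrN => /(le_trans (ler_norm _)) h.
by apply: (le_trans (key n)); lra.
Qed.

Variables (t0 : R) (La : (Y -> R) -> R).
Hypothesis t00 : 0 <= t0.
Hypothesis pLa : pos La.
Hypothesis domLa : forall x, dominated La (fun f => Q t0 f x).

(** After a suitable time r little mass lies on the exceptional set W. What lies off W becomes
    absolutely continuous with respect to p after t0 and contributes 0; what lies on W contributes
    at most twice its mass. *)
Lemma asym_incr_eq0 s L : 0 <= s -> pos L ->
  (forall W, measurable W -> p \1_W = 0 -> forall e : R, 0 < e ->
    exists2 r, 0 <= r & L (Q r \1_W) <= e) ->
  asym Q (incr Q s L) = 0.
Proof.
move=> s0 pL h; have sL := pL.1.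
have [W [mW pW domp]] := absolutely_continuous_off (kQ t00) pLa pp domLa
  (fun f => @inv t0 f t00).
apply/eqP; rewrite eq_le; apply/andP; split; last first.
  by apply: (asym_ge0 hQ); exact: (signed_incr hQ).
apply/ler_addgt0Pr => e e0; rewrite add0r.
have e2 : 0 < e / 2 by rewrite divr_gt0.
have [r r0 hr] := h _ mW pW _ e2.
pose M f := L (Q r f); have pM : pos M by exact: (posQ hQ).
have bW : bm (\1_W : Y -> R) by exact: bm_indic.
have bCO : bm (\1_(~` W) : Y -> R) by exact/bm_indic/measurableC.
have i0 A x : 0 <= (\1_A x : R) := @indic_ge0 _ Y R A x.
pose M1 f := M (fun x => \1_(~` W) x * f x).
pose M2 f := M (fun x => \1_W x * f x).
have p1 : pos M1 by exact: pos_restr.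
have p2 : pos M2 by exact: pos_restr.
have z : asym Q (incr Q s M1) = 0.
  rewrite -(asym_incrQ t00 s0 p1.1); apply: asym_incr_acont => //.
    exact: (posQ hQ).
  move=> N mN pN; rewrite /M1 (_ : (fun _ => _) = fun=> 0); first exact: (sg0 pM.1).
  apply/funext => x; rewrite indicE; case: (boolP (x \in ~` W)); last by rewrite mul0r.
  by rewrite inE => /= /domp -> //; rewrite mulr0.
rewrite -(asym_incrQ r0 s0 sL).
have -> : asym Q (incr Q s (fun f => L (Q r f))) =
    asym Q (fun f => incr Q s M1 f + incr Q s M2 f).
  apply: eq_asym hQ _ _ _ => f bf.
  have spl g : bm g -> L (Q r g) = M1 g + M2 g.
    move=> bg; rewrite -/(M g) /M1 /M2 -(sgD pM.1); [|exact: bmM..].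
    by congr M; apply/funext => x; rewrite indic_setC; ring.
  by rewrite /incr spl// [L (Q r (Q s f))]spl; [ring|exact: bmQ].
apply: (le_trans (asymD hQ (signed_incr hQ s0 p1.1) (signed_incr hQ s0 p2.1))).
rewrite z add0r (le_trans (asym_incr_le2 hQ s0 p2))//.
have -> : M2 (fun=> 1) = L (Q r \1_W).
  by rewrite /M2 /M; congr (L (Q r _)); apply/funext => x; rewrite mulr1.
lra.
Qed.

End invariant_measure.

(** Two factors [Q t0] are spent: with one, the continuity hypothesis gives setwise convergence of
    the laws started at x; with the other, [setwise_norm_cvg] improves it to the norm. The
    asymptotic norm ignores the delay t0 + t0. *)
Lemma osc_dyadic (t0 : R) (La : (Y -> R) -> R) : 0 <= t0 -> pos La ->
  (forall x, dominated La (fun f => Q t0 f x)) ->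
  (forall f x (u : nat -> R), bm f -> (forall n, 0 <= u n) ->
    u n @[n --> \oo] --> (0 : R) ->
    Q (u n) (Q t0 f) x @[n --> \oo] --> Q t0 f x) ->
  forall s x, 0 <= s -> osc Q (s / 2 ^+ n) x @[n --> \oo] --> (0 : R).
Proof.
move=> t00 pLa domLa cQ s x s0.
pose sn n : R := s / 2 ^+ n.
have sn0 n : 0 <= sn n by rewrite divr_ge0// exprn_ge0.
have csn : sn n @[n --> \oo] --> (0 : R).
  rewrite -(mulr0 s); apply: cvgM; first exact: cvg_cst.
  under eq_cvg do rewrite -exprVn.
  by apply: cvg_expr; rewrite ger0_norm ?invr_ge0// invf_lt1// ltr1n.
have px := pos_eval R x.
have K : nrm (fun f => Q (sn n) (Q t0 (Q t0 f)) x - Q t0 (Q t0 f) x)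
    @[n --> \oo] --> (0 : R).
  apply: (setwise_norm_cvg (al := fun n f => Q (sn n) (Q t0 f) x)
    (be := fun f => Q t0 f x) gU (kQ t00) pLa domLa).
  - by move=> n; exact: (posQ hQ t00 (posQ hQ (sn0 n) px)).
  - exact: (posQ hQ t00 px).
  - by move=> f bf; exact: cQ.
apply: (@squeeze_cvgr _ _ _ _ (fun=> 0) _ _ _ _ _ K); last exact: cvg_cst.
apply: nearW => n; rewrite (osc_ge0 hQ) ?sn0//=.
have t000 : 0 <= t0 + t0 by rewrite addr_ge0.
apply: (le_trans (asym_le_nrmQ hQ t000 (signed_incr hQ (sn0 n) px.1))).
have sD : signed (fun f => Q (sn n) (Q t0 (Q t0 f)) x - Q t0 (Q t0 f) x).
  apply: signedB; first exact: (posQ hQ t00 (posQ hQ t00 (posQ hQ (sn0 n) px))).1.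
  exact: (posQ hQ t00 (posQ hQ t00 px)).1.
apply: nrm_le => f bf; apply: le_trans (nrm_norm sD bf).
have bf' := bm1_bm bf.
by rewrite distrC (le_trans _ (ler_norm _))// /incr !(msgD hQ t00 t00 bf').
Qed.

End Invariant.

(** * Time averages *)

Section Calculus.
Context (R : realType).
Implicit Types (a b r t C : R) (G : R -> R).
Local Notation mu := (@lebesgue_measure R).

Lemma continuous_integrable G a b : {within `[a, b], continuous G} ->
  mu.-integrable `[a, b] (EFin \o G).
Proof. by move=> cG; apply: continuous_compact_integrable => //; exact: segment_compact. Qed.

Lemma Rintegral_shift G a b r : a <= b ->
  {within `[a + r, b + r], continuous G} ->
  \int[mu]_(x in `[a, b]) G (x + r) = \int[mu]_(x in `[a + r, b + r]) G x.
Proof.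
move=> ab cG; pose F := fun x : R => x + r.
have dF x : derive1 F x = 1.
  rewrite derive1E deriveD//; first by rewrite derive_id derive_cst addr0.
have eF : derive1 F = cst 1 by apply/funext => x; rewrite dF.
rewrite /Rintegral; congr fine.
rewrite -[`[a + r, b + r]]/(`[F a, F b]) integration_by_substitution_increasing//.
- by apply: eq_integral => x _; rewrite eF/= mulr1.
- by move=> x y _ _ xy; rewrite ltrD2r.
- by rewrite eF => x _; exact: cvg_cst.
- by rewrite eF; exact: is_cvg_cst.
- by rewrite eF; exact: is_cvg_cst.
- split => [x _|/=|/=].
  + exact: derivableD.
  + by apply: cvg_at_right_filter; apply: cvgD => //; exact: cvg_cst.
  + by apply: cvg_at_left_filter; apply: cvgD => //; exact: cvg_cst.
Qed.

Lemma lebesgue_itv a b : a <= b -> fine (mu `[a, b]) = b - a.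
Proof.
move=> ab; rewrite lebesgue_measure_itv/= lte_fin.
by case: ltP => //= ba; apply/esym/eqP; rewrite subr_eq0 eq_le ab ba.
Qed.

Lemma Rintegral_le_cst G a b C : a <= b -> {within `[a, b], continuous G} ->
  (forall x, a <= x <= b -> `|G x| <= C) ->
  `|\int[mu]_(x in `[a, b]) G x| <= C * (b - a).
Proof.
move=> ab cG GC; have iG := continuous_integrable cG.
apply: (le_trans (le_normr_Rintegral _ iG)) => //.
have -> : C * (b - a) = \int[mu]_(x in `[a, b]) C.
  by rewrite Rintegral_cst// lebesgue_itv.
apply: le_Rintegral => //.
- exact: (integrable_norm iG).
- by apply: continuous_integrable => x; exact: cvg_cst.
Qed.

Lemma Rintegral_ge_cst G a b C : a <= b -> {within `[a, b], continuous G} ->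
  (forall x, a <= x <= b -> C <= G x) ->
  C * (b - a) <= \int[mu]_(x in `[a, b]) G x.
Proof.
move=> ab cG GC; have iG := continuous_integrable cG.
have -> : C * (b - a) = \int[mu]_(x in `[a, b]) C.
  by rewrite Rintegral_cst// lebesgue_itv.
apply: le_Rintegral => //.
by apply: continuous_integrable => x; exact: cvg_cst.
Qed.

Lemma within_sub G a b : 0 <= a -> {within `[0, +oo[, continuous G} ->
  {within `[a, b], continuous G}.
Proof.
move=> a0; apply: continuous_subspaceW => x /=; rewrite !in_itv/= => /andP[ax _].
by rewrite (le_trans a0).
Qed.

(** The integrals over [r, t + r] and [0, t] differ by those over [t, t + r] and [0, r], each at
    most C r in absolute value. *)
Lemma Rintegral_shift_close G r t C : 0 <= r -> 0 <= t ->
  {within `[0, +oo[, continuous G} -> (forall x, 0 <= x -> `|G x| <= C) ->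
  `|\int[mu]_(x in `[0, t]) G (x + r) - \int[mu]_(x in `[0, t]) G x| <= 2 * C * r.
Proof.
move=> r0 t0 cG GC; have tr0 : 0 <= t + r by rewrite addr_ge0.
rewrite (@Rintegral_shift G) ?add0r//; last exact: within_sub.
have i0 : mu.-integrable `[0, t + r] (EFin \o G).
  by apply: continuous_integrable; exact: within_sub.
have obc a : 0 <= a -> a <= t + r ->
    \int[mu]_(x in `[a, t + r]) G x =
    \int[mu]_(x in `[0, t + r]) G x - \int[mu]_(x in `[0, a]) G x.
  move=> a0 atr; rewrite -Rintegral_itv_obnd_cbnd.
    by rewrite Rintegral_itvB ?bnd_simp.
  apply: integrableS i0 => //; apply: subset_itvScc; by rewrite bnd_simp.
rewrite obc ?lerDr//; have e2 : t <= t + r by rewrite lerDl.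
have {}e2 := obc t t0 e2.
have b1 : `|\int[mu]_(x in `[0, r]) G x| <= C * (r - 0).
  apply: Rintegral_le_cst => //; first exact: within_sub.
  by move=> x /andP[x0 _]; exact: GC.
have b2 : `|\int[mu]_(x in `[t, t + r]) G x| <= C * (t + r - t).
  apply: Rintegral_le_cst; [by rewrite lerDl|exact: within_sub|].
  by move=> x /andP[x0 _]; apply: GC; exact: le_trans x0.
move: b1 b2; rewrite e2 !ler_norml => /andP[? ?] /andP[? ?].
by apply/andP; split; lra.
Qed.

Lemma Rintegral_dominated (G_ : nat -> R -> R) a b C : a <= b ->
  (forall n, {within `[a, b], continuous (G_ n)}) ->
  (forall n x, a <= x <= b -> `|G_ n x| <= C) ->
  (forall x, a <= x <= b -> G_ n x @[n --> \oo] --> (0 : R)) ->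
  \int[mu]_(x in `[a, b]) G_ n x @[n --> \oo] --> (0 : R).
Proof.
move=> ab cG GC G0.
have iG n := continuous_integrable (cG n).
have iC : mu.-integrable `[a, b] (EFin \o cst C).
  by apply: continuous_integrable => x; exact: cvg_cst.
have h : (\int[mu]_(x in `[a, b]) (G_ n x)%:E)%E @[n --> \oo] -->
    (\int[mu]_(x in `[a, b]) 0)%E.
  have [] // := @dominated_convergence _ _ _ mu `[a, b]%classic
    (measurable_itv _) (fun n x => (G_ n x)%:E) (fun=> 0%E) (EFin \o cst C)
    (fun n => measurable_int mu (iG n)) (measurable_cst _) _ iC _.
  - apply: aeW => x; rewrite /= in_itv/= => xab.
    by apply: cvg_EFin; [exact: nearW|exact: G0].
  - by apply: aeW => x n; rewrite /= in_itv/= lee_fin => /GC.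
rewrite integral0 in h; exact: (fine_cvg h).
Qed.

End Calculus.

(** * Convergence for one positive measure, its averages being given abstractly *)

Section Convergence.
Context d (Y : measurableType d) (R : realType).
Implicit Types (s r t e : R) (f g : Y -> R) (S L : (Y -> R) -> R) (B N : set Y).
Local Notation mu := (@lebesgue_measure R).

Variable Q : R -> (Y -> R) -> Y -> R.
Hypothesis hQ : markov_sg Q.
Variable U : nat -> set Y.
Hypothesis gU : generates U.
Variables (t0 : R) (La : (Y -> R) -> R).
Hypothesis t00 : 0 <= t0.
Hypothesis pLa : pos La.
Hypothesis domLa : forall x, dominated La (fun f => Q t0 f x).
Hypothesis cQ : forall f x (u : nat -> R), bm f -> (forall n, 0 <= u n) ->
  u n @[n --> \oo] --> (0 : R) -> Q (u n) (Q t0 f) x @[n --> \oo] --> Q t0 f x.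

Variables (L : (Y -> R) -> R) (al : R -> (Y -> R) -> R) (p0 : (Y -> R) -> R).
Hypothesis pL : pos L.
Hypothesis cL : forall f, bm f ->
  {within `[0, +oo[, continuous (fun s => L (Q s (Q t0 f)))}.
Hypothesis pal : forall t, 0 < t -> pos (al t).
Hypothesis alE : forall t f, 0 < t -> bm f ->
  al t (Q t0 f) = t^-1 * \int[mu]_(s in `[0, t]) L (Q s (Q t0 f)).
Hypothesis sp0 : signed p0.
Hypothesis cal : forall f, bm f -> al t f @[t --> +oo] --> p0 f.

Let L1 := L (fun=> 1).

Let cal_near f e : bm f -> 0 < e ->
  exists M : R, forall t, M < t -> `|p0 f - al t f| <= e.
Proof.
by move=> bf e0; have /cvgrPdist_le/(_ _ e0)[M [_ hM]] := cal bf; exists M.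
Qed.

(** The index n.+1 keeps the times positive, as [pal] requires. *)
Let cal_seq f : bm f -> al n.+1%:R f @[n --> \oo] --> p0 f.
Proof.
move=> bf; apply/cvgrPdist_le => e e0; have [M hM] := cal_near bf e0.
exists (Num.trunc `|M|).+1 => // n /= hn; apply: hM.
rewrite (le_lt_trans (ler_norm _))// (lt_trans (truncnS_gt _))// ltr_nat ltnS//.
Qed.

Let pp0 : pos p0.
Proof.
split => // f bf f0; have c := cal_seq bf.
rewrite -(cvg_lim _ c)//; apply: limr_ge; first exact: cvgP c.
by apply: nearW => n; apply: (pal _).2.
Qed.

(** [alE] computes the averages only at functions [Q t0 f], so the limit [p0] is used through one
    such factor; the pi of the overview is this p. *)
Let p f := p0 (Q t0 f).
Let pp : pos p := posQ hQ t00 pp0.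

Let bound f : bm f -> exists2 C : R, 0 <= C & forall s, 0 <= s -> `|L (Q s (Q t0 f))| <= C.
Proof.
move=> bf; have [M fM] := bf.2.
exists (`|M| * L1); first by rewrite mulr_ge0// pos1_ge0.
move=> s s0; apply: (pos_bound pL).
  by apply: (bmQ hQ) => //; exact: bmQ.
move=> x; rewrite -(msgD hQ)//; have st0 : 0 <= s + t0 by rewrite addr_ge0.
have := pos_bound (mk_pos (msg_mk hQ st0) x) bf (fun y => le_trans (fM y) (ler_norm M)).
by rewrite (mk_one (msg_mk hQ st0)) mulr1.
Qed.

(** Shifting the averaging window by r changes the average by at most 2 C r / t, which vanishes in
    the limit. *)
Let inv r f : 0 <= r -> bm f -> p (Q r f) = p f.
Proof.
move=> r0 bf; rewrite /p (QC hQ)//.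
have bt := bmQ hQ t00 bf; have btr := bmQ hQ r0 bt.
apply/eqP; rewrite -subr_eq0 -normr_le0; apply/ler_addgt0Pr => e e0; rewrite add0r.
have [C C0 hC] := bound bf.
have e4 : 0 < e / 4 by rewrite divr_gt0.
have [M1 h1] := cal_near btr e4; have [M2 h2] := cal_near bt e4.
(* Positive, beyond the thresholds of both limits, and so large that 2 C r / t <= e / 4. *)
pose t := Num.max (Num.max (M1 + 1) (M2 + 1)) (Num.max 1 (2 * C * r / (e / 4))).
have t1 : 1 <= t by rewrite /t !le_max lexx !orbT.
have tp : 0 < t by rewrite (lt_le_trans ltr01).
have tM1 : M1 < t by rewrite /t !lt_max ltrDl ltr01.
have tM2 : M2 < t by rewrite /t !lt_max ltrDl ltr01 orbT.
have tC : 2 * C * r / (e / 4) <= t by rewrite /t !le_max lexx !orbT.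
have := h1 _ tM1; have := h2 _ tM2.
have -> : al t (Q r (Q t0 f)) = t^-1 * \int[mu]_(s in `[0, t]) L (Q (s + r) (Q t0 f)).
  rewrite (QC hQ)// alE//; last exact: bmQ.
  congr (_ * _); apply: eq_Rintegral => s; rewrite inE/= in_itv/= => /andP[s0 _].
  by rewrite (QC hQ t00 r0)// (msgD hQ).
rewrite alE//.
have := Rintegral_shift_close r0 (ltW tp) (cL bf) hC.
set I1 := \int[mu]_(x in _) _; set I2 := \int[mu]_(x in _) _ => hI.
have : `|t^-1 * I1 - t^-1 * I2| <= e / 4.
  rewrite -mulrBr normrM ger0_norm ?invr_ge0 ?(ltW tp)//.
  rewrite mulrC ler_pdivrMr// (le_trans hI)//.
  by move: tC; rewrite ler_pdivrMr// (mulrC (e / 4)).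
rewrite !ler_norml => /andP[? ?] /andP[? ?] /andP[? ?].
by apply/andP; split; lra.
Qed.

(** Ergodicity enters here: if the mass of W stayed above e at all times, so would the averages at
    [Q t0 \1_W], whose limit is p(W) = 0. *)
Let asym_incr0 s : 0 <= s -> asym Q (incr Q s L) = 0.
Proof.
move=> s0; apply: (asym_incr_eq0 hQ gU pp inv _ t00 pLa domLa s0 pL).
  exact: (osc_dyadic hQ gU t00 pLa domLa cQ).
move=> W mW pW e e0; apply: contrapT => hno.
have bW : bm (\1_W : Y -> R) by exact: bm_indic.
have bt := bmQ hQ t00 bW.
have e2 : 0 < e / 2 by rewrite divr_gt0.
have [M hM] := cal_near bt e2.
pose t := Num.max (M + 1) 1.
have tp : 0 < t by rewrite lt_max ltr01 orbT.
have tM : M < t by rewrite lt_max ltrDl ltr01.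
have := hM _ tM; rewrite -/(p \1_W) pW sub0r normrN => /(le_trans (ler_norm _)).
rewrite alE// leNgt => /negP; apply.
apply: (@lt_le_trans _ _ e); first lra.
have : e * (t - 0) <= \int[mu]_(s in `[0, t]) L (Q s (Q t0 \1_W)).
  apply: Rintegral_ge_cst; [exact: ltW|exact: within_sub (lexx 0) (cL bW)|].
  move=> x /andP[x0 _]; rewrite leNgt; apply/negP => hx; apply: hno.
  exists (x + t0); first by rewrite addr_ge0.
  by rewrite (msgD hQ)// ltW.
by rewrite subr0 (mulrC t^-1) ler_pdivlMr.
Qed.

(** The norm of a time average is bounded through a test function [F n] attaining it for each n: it
    becomes one integral over s, whose integrand is at most a norm that tends to 0 for each s, and
    dominated convergence applies. *)
Let asym_average t : 0 < t -> asym Q (fun f => L f - al t (Q t0 f)) = 0.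
Proof.
move=> tp; have sD : signed (fun f => L f - al t (Q t0 f)).
  by apply: signedB; [exact: pL.1|exact: (posQ hQ t00 (pal tp)).1].
have sDn n : signed (fun f => L (Q n%:R f) - al t (Q t0 (Q n%:R f))).
  exact: (signedQ hQ (ler0n _ n) sD).
have /choice[F hF] : forall n : nat, exists f, bm1 f /\
    nrm (fun f => L (Q n%:R f) - al t (Q t0 (Q n%:R f))) =
    L (Q n%:R f) - al t (Q t0 (Q n%:R f)).
  by move=> n; have [f [bf ef]] := nrm_max (sDn n); exists f.
have bF n : bm (F n) by apply: bm1_bm; case: (hF n).
have bQF n : bm (Q n%:R (F n)) by exact: bmQ.
pose G n s := L (Q n%:R (F n)) - L (Q s (Q t0 (Q n%:R (F n)))).
have cG n : {within `[0, t], continuous (G n)}.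
  move=> x; apply: cvgB; first exact: cvg_cst.
  exact: (within_sub (lexx 0) (cL (bQF n))).
have GE n : nrm (fun f => L (Q n%:R f) - al t (Q t0 (Q n%:R f))) =
    t^-1 * \int[mu]_(s in `[0, t]) G n s.
  have [_ ->] := hF n; rewrite alE// /G RintegralB//.
  - rewrite Rintegral_cst// lebesgue_itv ?(ltW tp)// subr0 mulrBr mulrCA.
    by rewrite mulVf ?mulr1// lt0r_neq0.
  - by apply: continuous_integrable => x; exact: cvg_cst.
  - by apply: continuous_integrable; exact: within_sub (lexx 0) (cL (bQF n)).
have Gincr n s : 0 <= s -> G n s = incr Q (s + t0) L (Q n%:R (F n)).
  by move=> s0; rewrite /G /incr (msgD hQ).
have sI s : 0 <= s -> signed (incr Q (s + t0) L).
  by move=> s0; apply: (signed_incr hQ); [rewrite addr_ge0|exact: pL.1].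
have Gle n s : 0 <= s -> `|G n s| <= nrm (fun f => incr Q (s + t0) L (Q n%:R f)).
  move=> s0; rewrite Gincr//; apply: (nrm_norm (signedQ hQ (ler0n _ n) (sI _ s0))).
  by case: (hF n).
have c : \int[mu]_(s in `[0, t]) G n s @[n --> \oo] --> (0 : R).
  apply: (@Rintegral_dominated _ _ _ _ (2 * L1)) => //; first exact: ltW.
    move=> n s /andP[s0 _]; apply: (le_trans (Gle n s s0)).
    apply: (le_trans (nrmQ hQ (ler0n _ n) (sI s s0))).
    by apply: (incr_le2 hQ _ pL); rewrite addr_ge0.
  move=> s /andP[s0 _]; have st0 : 0 <= s + t0 by rewrite addr_ge0.
  have := asym_cvg hQ (sI s s0); rewrite asym_incr0// => cn.
  apply/cvgrPdist_le => e e0; have /cvgrPdist_le/(_ _ e0)[n0 _ hn] := cn.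
  exists n0 => // n /hn; rewrite !sub0r !normrN; apply: le_trans.
  by rewrite (le_trans (Gle n s s0))// ler_norm.
have c1 := asym_cvg hQ sD.
have c2 : nrm (fun f => L (Q n%:R f) - al t (Q t0 (Q n%:R f))) @[n --> \oo] --> (0 : R).
  under eq_cvg do rewrite GE.
  have := @cvgM _ _ _ _ _ _ _ _ (cvg_cst t^-1) c; rewrite mulr0; exact.
exact: (cvg_unique _ c1 c2).
Qed.

(** L - p splits into L minus a smoothed average, of asymptotic norm 0, and that average minus p,
    small in norm after one more [Q t0]. Invariance of p then turns (L - p) Q_t into L Q_t - p. *)
Lemma nrm_convergence e : 0 < e -> exists M : R, forall t, M <= t ->
  nrm (fun f => L (Q t f) - p0 (Q t0 f)) <= e.
Proof.
move=> e0; have e2 : 0 < e / 2 by rewrite divr_gt0.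
have sD : signed (fun f => L f - p f) by apply: signedB; [exact: pL.1|exact: pp.1].
have K : nrm (fun f => al n.+1%:R (Q t0 (Q t0 f)) - p (Q t0 f))
    @[n --> \oo] --> (0 : R).
  apply: (setwise_norm_cvg (al := fun n f => al n.+1%:R (Q t0 f)) (be := p)
    gU (msg_mk hQ t00) pLa domLa) => //.
    by move=> n; apply: (posQ hQ t00); exact: pal.
  by move=> f bf; apply: cal_seq; exact: bmQ.
have a0 : asym Q (fun f => L f - p f) <= 0.
  apply/ler_addgt0Pr => t tp; rewrite add0r.
  have /cvgrPdist_le/(_ _ tp)[n _ /(_ n (leqnn n))] := K.
  rewrite sub0r normrN => /(le_trans (ler_norm _)) hn.
  have n1 : 0 < n.+1%:R :> R by rewrite ltr0n.
  have s1 : signed (fun f => L f - al n.+1%:R (Q t0 f)).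
    by apply: signedB; [exact: pL.1|exact: (posQ hQ t00 (pal n1)).1].
  have s2 : signed (fun f => al n.+1%:R (Q t0 f) - p f).
    by apply: signedB; [exact: (posQ hQ t00 (pal n1)).1|exact: pp.1].
  have -> : asym Q (fun f => L f - p f) = asym Q (fun f =>
      (L f - al n.+1%:R (Q t0 f)) + (al n.+1%:R (Q t0 f) - p f)).
    by apply: (eq_asym hQ) => f bf; ring.
  apply: (le_trans (asymD hQ s1 s2)); rewrite asym_average// add0r.
  exact: (le_trans (asym_le_nrmQ hQ t00 s2)).
have [n hn] := asym_near hQ sD e0.
exists n%:R => t nt; have t_ge0 : 0 <= t by exact: le_trans nt.
have -> : nrm (fun f => L (Q t f) - p0 (Q t0 f)) = nrm (fun f => L (Q t f) - p (Q t f)).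
  by apply: eq_nrm => f bf; rewrite inv//; exact: bm1_bm.
apply: (le_trans (nrmQ_dec hQ (ler0n _ n) nt sD)); lra.
Qed.

End Convergence.

(** * Finite measures as positive functionals *)

Section MeasureFunctional.
Context d (Y : measurableType d) (R : realType).
Implicit Types (f g : Y -> R) (B : set Y).

Section finite_measure.
Variable m : {measure set Y -> \bar R}.
Hypothesis mfin : (m setT < +oo)%E.

Lemma bm_integrable f : bm f -> m.-integrable setT (EFin \o f).
Proof.
move=> [mf [M fM]]; apply: measurable_bounded_integrable => //.
exists M; split; first exact: num_real.
by move=> K MK x _ /=; rewrite (le_trans (fM x))// ltW.
Qed.

Lemma pos_Rintegral : pos (fun f => \int[m]_x f x).
Proof.
split; last by move=> f bf f0; apply: Rintegral_ge0.
split.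
  move=> a f g bf bg; rewrite RintegralD//; [|exact: (bm_integrable (bmZ a bf))|exact: bm_integrable].
  by rewrite RintegralZl//; exact: bm_integrable.
move=> F f Ff; have bf := bm_cvg Ff; have [mF [M FM] cF] := Ff.
have iC : m.-integrable setT (EFin \o cst M) by exact: (bm_integrable (bm_cst Y M)).
have h : (\int[m]_x (F n x)%:E)%E @[n --> \oo] --> (\int[m]_x (f x)%:E)%E.
  have [] // := @dominated_convergence _ _ _ m setT measurableT
    (fun n x => (F n x)%:E) (EFin \o f) (EFin \o cst M) _ _ _ iC _.
  - by move=> n; apply/measurable_EFinP.
  - by apply/measurable_EFinP; case: bf.
  - by apply: aeW => x _; apply: cvg_EFin; [exact: nearW|exact: cF].
  - by apply: aeW => x n _; rewrite /= lee_fin.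
apply: fine_cvg.
by rewrite fineK//; exact: (integrable_fin_num measurableT (bm_integrable bf)).
Qed.

Lemma Rintegral_indic B : measurable B -> \int[m]_x \1_B x = fine (m B).
Proof. by move=> mB; rewrite /Rintegral integral_indic// setIT. Qed.

End finite_measure.
End MeasureFunctional.

(** * Markovian semigroups on signed measures *)

Section Interface.
Context (R : realType) (X : ptopologicalType).
Implicit Types (f g : X -> R) (mu nu : signed_measure R X) (B : set (borel X)).
Local Notation Y := (borel X).

Lemma B_bP f : B_b f <-> @bm _ Y R f.
Proof.
split=> -[mf hf]; split => //.
  move: hf => [M [_ hM]]; exists (M + 1) => x.
  by apply: (hM (M + 1)) => //; rewrite ltrDl.
case: hf => M hM; exists M; split; first exact: num_real.
by move=> K MK x _ /=; rewrite (le_trans (hM x))// ltW.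
Qed.

Lemma signed_pairing mu : @signed _ Y R (pairing mu).
Proof.
have h (m : {measure set Y -> \bar R}) : (m setT < +oo)%E ->
    @signed _ Y R (fun f => \int[m]_x f x) by move=> /pos_Rintegral[].
apply: signedB; apply: h; rewrite -ge0_fin_numE//; exact: fin_num_measure.
Qed.

Lemma pairing_indic mu B : measurable B -> pairing mu \1_B = fine (mu B).
Proof.
move=> mB; rewrite /pairing !Rintegral_indic// (jordan_decomp (hahn_pos_neg mu) mB).
set h := hahn_pos_neg mu.
rewrite -[cadd _ _ B]/(jordan_pos h B + (-1)%:E * jordan_neg h B)%E.
have f1 : jordan_pos h B \is a fin_num by exact: fin_num_measure.
have f2 : jordan_neg h B \is a fin_num by exact: fin_num_measure.
rewrite fineD//; last by rewrite fin_numM.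
rewrite fineM//=.
by rewrite mulN1r.
Qed.

Lemma eq_pairing mu nu f : charge_eq mu nu -> @bm _ Y R f ->
  pairing mu f = pairing nu f.
Proof.
move=> e; apply: (eq_signed (signed_pairing mu) (signed_pairing nu)) => B mB.
by rewrite !pairing_indic// e.
Qed.

Lemma pairingB mu nu f : @bm _ Y R f ->
  pairing (cadd mu (copp nu)) f = pairing mu f - pairing nu f.
Proof.
move: f; apply: (@eq_signed _ Y R (pairing (cadd mu (copp nu)))
    (fun f => pairing mu f - pairing nu f)).
- exact: signed_pairing.
- exact: signedB (signed_pairing mu) (signed_pairing nu).
move=> B mB; rewrite !pairing_indic//= /cadd/= /copp fineD ?fineN//.
  exact: fin_num_measure.
by rewrite fin_numN; exact: fin_num_measure.
Qed.

Definition nonneg_charge mu : Prop := forall B, measurable B -> (0 <= mu B)%E.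

Lemma pos_pairing mu : nonneg_charge mu -> @pos _ Y R (pairing mu).
Proof.
move=> mu0; split; first exact: signed_pairing.
move=> f; apply: signed_ge0; first exact: signed_pairing.
by move=> B mB; rewrite pairing_indic// fine_ge0// mu0.
Qed.

(** The total variation is the pairing with the difference of the indicators of a Hahn pair, a test
    function bounded by 1. *)
Lemma tv_norm_le mu : 0 <= tv_norm mu <= @nrm _ Y R (pairing mu).
Proof.
rewrite /tv_norm /charge_variation/=; set h := hahn_pos_neg mu.
have [[mP _] [mN _] _ _] := h.
have fp := fin_num_measure (jordan_pos h) _ measurableT.
have fn := fin_num_measure (jordan_neg h) _ measurableT.
rewrite fine_ge0 ?adde_ge0//= fineD//.
have -> : jordan_pos h setT = mu (hahn_pos mu).
  by rewrite jordan_posE cjordan_posE /crestr0 mem_set// /crestr setTI.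
have -> : jordan_neg h setT = (- mu (hahn_neg mu))%E.
  by rewrite jordan_negE cjordan_negE /crestr0 mem_set// /crestr setTI.
rewrite fineN -!pairing_indic//.
have bP : @bm _ Y R \1_(hahn_pos mu) by exact: bm_indic.
have bN : @bm _ Y R \1_(hahn_neg mu) by exact: bm_indic.
rewrite -(sgB (signed_pairing mu) bP bN); apply: nrm_ub; first exact: signed_pairing.
split; first by case: (bmB bP bN).
move=> x; have /andP[? ?] := @indic_01 _ Y R (hahn_pos mu) x.
have /andP[? ?] := @indic_01 _ Y R (hahn_neg mu) x.
by rewrite ler_norml; apply/andP; split; lra.
Qed.

Definition point_charge (x : X) : signed_measure R X :=
  charge_of_finite_measure (dirac (x : Y)).

Lemma pairing_point x f : @bm _ Y R f -> pairing (point_charge x) f = f x.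
Proof.
apply: (eq_signed (signed_pairing _) (@pos_eval _ Y R x).1) => B mB.
by rewrite pairing_indic//= /charge_of_finite_measure diracE indicE.
Qed.

Section kernel.
Variables (k : transition_kernel R X).

Lemma kernel_bound x B : measurable B -> (0 <= k x B <= 1)%E.
Proof.
move=> mB; rewrite measure_ge0/= -(@prob_kernel _ _ _ _ _ k x).
by apply: le_measure; rewrite ?inE.
Qed.

Lemma bm_kernel B : measurable B -> @bm _ Y R (fun x => fine (k x B)).
Proof.
move=> mB; split.
  by apply: measurableT_comp => //; exact: measurable_kernel.
exists 1 => x; have /andP[k0 k1] := kernel_bound x mB.
rewrite ger0_norm ?fine_ge0// -lee_fin fineK// ge0_fin_numE//.
by rewrite (le_lt_trans k1)// ltry.
Qed.

Variable S : operator R X.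
Hypothesis hS : has_kernel S k.

(** Built from S alone through point masses, so that no kernel has to be chosen along the semigroup;
    [dual_opE] identifies it with the adjoint of any kernel of S. *)
Definition dual_op f (x : X) : R := pairing (S (point_charge x)) f.

Lemma dual_op_indic B x : measurable B -> dual_op \1_B x = fine (k x B).
Proof.
by move=> mB; rewrite /dual_op pairing_indic// hS//= pairing_point//; exact: bm_kernel.
Qed.

Lemma nonneg_has_kernel mu : nonneg_charge mu -> nonneg_charge (S mu).
Proof.
move=> mu0 B mB; rewrite hS// lee_fin; apply: (pos_pairing mu0).2.
  exact: bm_kernel.
by move=> x; rewrite fine_ge0.
Qed.

Lemma markov_dual_op : @markov_op _ Y R dual_op.
Proof.
split.
- move=> x; apply/pos_pairing/nonneg_has_kernel => B mB.
  by rewrite /= /charge_of_finite_measure.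
- apply/funext => x; rewrite (_ : (fun=> 1) = \1_[set: Y]).
    by rewrite dual_op_indic// prob_kernel.
  by apply/funext => y; rewrite indicT.
apply: bm_ind.
- move=> B mB; rewrite (_ : dual_op \1_B = fun x => fine (k x B)).
    exact: bm_kernel.
  by apply/funext => x; exact: dual_op_indic.
- move=> a f g bf bg bQf bQg.
  rewrite (_ : dual_op _ = fun x => a * dual_op f x + dual_op g x).
    by apply: bmD => //; exact: bmZ.
  by apply/funext => x; rewrite /dual_op (sg_lin (signed_pairing _)).
- move=> F f Ff bQF.
  have pS x : @pos _ Y R (pairing (S (point_charge x))).
    by apply/pos_pairing/nonneg_has_kernel => B mB; rewrite /= /charge_of_finite_measure.
  have [mF [M FM] cF] := Ff.
  apply: (@bm_cvg _ Y R (fun n => dual_op (F n))); split.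
  + by move=> n; case: (bQF n).
  + exists M => n x; rewrite /dual_op.
    have bFn : @bm _ Y R (F n) by split => //; exists M.
    apply: (le_trans (pos_bound (pS x) bFn (FM n))).
    rewrite (_ : (fun=> 1) = \1_[set: Y]); last by apply/funext => y; rewrite indicT.
    by rewrite -/(dual_op _ x) dual_op_indic// prob_kernel mulr1.
  + by move=> x; exact: (sg_cts (signed_pairing _)).
Qed.

(** Both sides are signed functionals of f, and on indicators the claim is the kernel formula for
    S. *)
Lemma pairing_dual_op mu f : @bm _ Y R f -> pairing (S mu) f = pairing mu (dual_op f).
Proof.
move: f; apply: (@eq_signed _ Y R (pairing (S mu)) (fun f => pairing mu (dual_op f))).
- exact: signed_pairing.
- exact: signed_markov markov_dual_op (signed_pairing mu).
move=> B mB; rewrite pairing_indic// hS//=; congr pairing.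
by apply/funext => x; rewrite dual_op_indic.
Qed.

Lemma dual_opE f : @bm _ Y R f -> dual_op f = kernel_adjoint k f.
Proof.
move=> bf; apply/funext => x; move: f bf.
apply: (@eq_signed _ Y R (fun f => dual_op f x) (fun f => \int[k x]_y f y)).
- exact: signed_pairing.
- by apply: (pos_Rintegral _).1; rewrite prob_kernel ltry.
by move=> B mB; rewrite Rintegral_indic// -dual_op_indic.
Qed.

End kernel.

(** * Consequences of the Polish topology *)

Section topology.
Hypothesis pol : polish R X.

Lemma polish_dense : exists u : nat -> X, dense (range u).
Proof.
have [[D cD dD] _] := pol.
have [x0 [_ Dx0]] : ([set: X] `&` D) !=set0.
  by apply: dD; [exists point|exact: openT].
move: cD => /pfcard_geP[D0|[u]].
  by rewrite D0 in Dx0.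
exists u => V V0 oV; have [x [Vx Dx]] := dD V V0 oV.
have [n _ un] := @surj _ _ _ _ u x Dx.
by exists x; split => //; exists n.
Qed.

Lemma borel_open (V : set X) : open V -> measurable (V : set Y).
Proof. by move=> oV; exact: sub_sigma_algebra. Qed.

(** The balls of radius 1/(j+1) around a dense sequence form a countable base: an open set is the
    union of those it contains. *)
Lemma borel_generated : exists U : nat -> set Y, generates U.
Proof.
have [u du] := polish_dense.
have [_ [dd [[dd0 ddx ddC ddT] ind _]]] := pol.
pose ballU (i j : nat) : set X := [set y | dd (u i) y < j.+1%:R^-1].
have oball x e : 0 < e -> open [set y | dd x y < e].
  move=> e0; rewrite openE => y /= xy; apply/ind; exists (e - dd x y).
    by rewrite subr_gt0.
  by move=> z /= yz; rewrite (le_lt_trans (ddT x y z))// -ltrBrDl.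
pose U n : set Y := if unpickle n is Some (i, j) then ballU i j else set0.
have mU n : measurable (U n).
  rewrite /U; case: unpickle => [[i j]|]; last exact: measurable0.
  by apply: borel_open; exact: oball.
exists U; split => // G sG GU B.
apply: (@smallest_sub _ (sigma_algebra [set: Y]) (@open X) G sG _ B) => V oV.
have -> : V = \bigcup_(n in [set n | U n `<=` V]) U n.
  apply/seteqP; split => [x Vx|x [n /= UV Ux]]; last exact: UV.
  have /ind[e e0 he] : nbhs x V by exact: open_nbhs_nbhs.
  have e2 : 0 < e / 2 by rewrite divr_gt0.
  (* With radius at most e / 2, a ball whose centre is that close to x stays within e of x. *)
  pose j := Num.trunc (e / 2)^-1.
  have je : j.+1%:R^-1 <= e / 2.
    by rewrite -[leRHS]invrK lef_pV2 ?posrE ?ltr0n ?invr_gt0// ltW// truncnS_gt.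
  have j0 : 0 < j.+1%:R^-1 :> R by rewrite invr_gt0 ltr0n.
  have [y [xy [i _ iy]]] : ([set y | dd x y < j.+1%:R^-1] `&` range u) !=set0.
    apply: du; last exact: oball.
    by exists x; rewrite /= (ddx x x).2.
  exists (pickle (i, j)); rewrite /U/= pickleK.
    move=> z /= iz; apply: he => /=.
    have yz : dd y z < j.+1%:R^-1 by rewrite -iy.
    by rewrite (le_lt_trans (ddT x y z))//; move: xy yz je => /=; set c := j.+1%:R^-1; lra.
  by rewrite /ballU/= ddC iy.
case: sG => G0 GC GUn; rewrite bigcup_mkcond; apply: GUn => n.
by case: ifP.
Qed.

(** La is the image under Q of m, a sum of point masses on a dense sequence with weights 1/2^(n+1).
    If La(N) = 0, the open set where [Q \1_N] is positive is m-null; were it nonempty, it would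
    contain an atom of m. *)
Lemma strong_feller_dominated (Q : (X -> R) -> X -> R) : @markov_op _ Y R Q ->
  (forall f, @bm _ Y R f -> continuous (Q f)) ->
  exists2 La, @pos _ Y R La & forall x, dominated La (fun f => Q f x).
Proof.
move=> kQ cQ; have [u du] := polish_dense.
have w0 (n : nat) : 0 <= 1 / (2 ^ (n + 1))%:R :> R by rewrite divr_ge0.
pose ms (n : nat) : {measure set Y -> \bar R} := mscale (NngNum (w0 n)) (dirac (u n : Y)).
pose m : {measure set Y -> \bar R} := mseries ms 0.
have mfin : (m setT < +oo)%E.
  have c := @cvg_geometric_eseries_half R 1 0.
  have -> : m setT = limn (eseries (fun k => (1 / (2 ^ (k + 1))%:R : R)%:E)).
    apply: congr_lim; apply/funext => n; rewrite /eseries/=.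
    by apply: eq_bigr => k _; rewrite /ms/= /mscale/= diracT mule1.
  by rewrite (cvg_lim _ c)// ltry.
have pm := pos_Rintegral mfin.
exists (fun f => \int[m]_x Q f x).
  exact: (pos_markov kQ pm).
move=> x N mN; set g := Q \1_N => mg.
have bN : @bm _ Y R \1_N by exact: bm_indic.
have bg : @bm _ Y R g by exact: mk_bm.
have g0 y : 0 <= g y.
  by apply: (mk_pos kQ y).2 => // z; exact: indic_ge0.
have [mW] := pos_null_support pm bg g0 mg.
rewrite Rintegral_indic// => mW0.
have {}mW0 : m [set y | 0 < g y] = 0%E.
  rewrite -[LHS]fineK ?mW0// ge0_fin_numE//.
  by rewrite (le_lt_trans _ mfin)// le_measure ?inE.
apply/eqP; rewrite eq_le g0 andbT leNgt; apply/negP => gx.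
have [y [gy [n _ un]]] : ([set y | 0 < g y] `&` range u) !=set0.
  apply: du; first by exists x.
  by move/continuousP: (cQ _ bN) => /(_ _ (@open_gt R 0)).
set W := [set y | 0 < g y] in mW mW0 gy.
have : (ms n W <= m W)%E.
  rewrite /m/= /mseries; apply: (@le_trans _ _ (\sum_(0 <= k < n.+1) ms k W)%E).
    by rewrite big_nat_recr//= leeDr// sume_ge0.
  exact: nneseries_lim_ge.
rewrite mW0 /ms/= /mscale/= un diracE mem_set// mule1 lee_fin leNgt.
by rewrite divr_gt0.
Qed.

End topology.

Lemma dist_sub_le (a b a' b' e : R) :
  `|a - a'| <= e / 2 -> `|b - b'| <= e / 2 -> a - b - (a' - b') <= e.
Proof. by rewrite !ler_norml => /andP[? ?] /andP[? ?]; lra. Qed.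

(** * Transfer to the semigroup on signed measures *)

Section main.
Hypothesis pol : polish R X.
Variables (T : R -> operator R X).
Hypothesis hT : markovian_semigroup T.
Hypothesis hTc : stochastically_continuous T.
Variable t0 : R.
Hypothesis t00 : 0 < t0.
Hypothesis hTf : strong_feller (T t0).

Let Q t := dual_op (T t).

Lemma markovian_dual t : 0 <= t -> exists k : transition_kernel R X, has_kernel (T t) k.
Proof. by case: hT => hM _ _ /hM[]. Qed.

Lemma pairing_dual mu t f : 0 <= t -> @bm _ Y R f ->
  pairing (T t mu) f = pairing mu (Q t f).
Proof. by move=> /markovian_dual[k hk]; exact: pairing_dual_op hk mu f. Qed.

Lemma dual_semigroup : @markov_sg _ Y R Q.
Proof.
have [_ hD h0] := hT; split.
- by move=> t /markovian_dual[k hk]; exact: markov_dual_op hk.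
- move=> s t s0 t_ge0 f bf; apply/funext => x; rewrite addrC /Q /dual_op.
  have bQ : @bm _ Y R (Q t f).
    by have [k hk] := markovian_dual t_ge0; exact: (mk_bm (markov_dual_op hk)).
  rewrite (eq_pairing (hD t s t_ge0 s0 _) bf) pairing_dual//.
- by move=> f bf; apply/funext => x; rewrite /Q /dual_op (eq_pairing (h0 _) bf) pairing_point.
Qed.

Lemma dual_feller f : @bm _ Y R f -> C_b (Q t0 f).
Proof.
move=> bf; have [_ [k hk kf]] := hTf; rewrite /Q (dual_opE hk bf).
by apply: kf; apply/B_bP.
Qed.

(** The strong Feller property puts [Q t0 f] in [C_b], where stochastic continuity applies. *)
Lemma dual_orbit_continuous mu f : @bm _ Y R f ->
  {within `[0, +oo[, continuous (fun s => pairing mu (Q s (Q t0 f)))}.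
Proof.
move=> bf; have := @hTc _ mu (dual_feller bf); apply: subspace_eq_continuous => s.
rewrite in_setE => s_ge0; have s0 : 0 <= s by move: s_ge0; rewrite /= in_itv/= andbT.
change (pairing (T s mu) (Q t0 f) = pairing mu (Q s (Q t0 f))).
by apply: pairing_dual => //; apply: (mk_bm (msg_mk dual_semigroup (ltW t00))).
Qed.

Lemma dual_orbit_cvg0 f x (u : nat -> R) : @bm _ Y R f -> (forall n, 0 <= u n) ->
  u n @[n --> \oo] --> (0 : R) ->
  Q (u n) (Q t0 f) x @[n --> \oo] --> Q t0 f x.
Proof.
move=> bf u0 cu; have bQf := mk_bm (msg_mk dual_semigroup (ltW t00)) bf.
have := dual_orbit_continuous (mu := point_charge x) bf.
move=> /subspace_continuousP/(_ 0) c.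
have {}c := c _.
have h0 : `[0, +oo[%classic (0 : R) by rewrite /= in_itv/= lexx.
have {}c := c h0.
apply/cvgrPdist_le => e e0; have /cvgrPdist_le/(_ _ e0) := c.
rewrite near_withinE /from_subspace (msg0 dual_semigroup bQf) pairing_point// => h.
have [N _ hN] := cu _ h; exists N => // n /hN/= hn.
have := hn _; rewrite pairing_point//.
  by apply; rewrite in_itv/= u0.
exact: (mk_bm (msg_mk dual_semigroup (u0 n))).
Qed.

(** [pairing (T t0 nu)] is the functional p of the abstract result, read as a signed measure. *)
Lemma nonneg_convergence (A : R -> operator R X)
    (hA : forall t, 0 < t -> is_average T t (A t)) mu nu :
  nonneg_charge mu ->
  (forall f, B_b f -> pairing (A t mu) f @[t --> +oo] --> pairing nu f) ->
  forall e : R, 0 < e -> exists M : R, forall t, M <= t ->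
    @nrm _ Y R (fun f => pairing mu (Q t f) - pairing (T t0 nu) f) <= e.
Proof.
move=> mu0 cA e e0; have t0_ge0 := ltW t00.
have sg := dual_semigroup.
have [U gU] := borel_generated pol.
have [La pLa domLa] := strong_feller_dominated pol (msg_mk sg t0_ge0)
  (fun f bf => (dual_feller bf).1).
have pA t : 0 < t -> @pos _ Y R (pairing (A t mu)).
  by move=> tp; have [[_ [k hk]] _] := @hA t tp; exact/pos_pairing/(nonneg_has_kernel hk).
have alE t f : 0 < t -> @bm _ Y R f -> pairing (A t mu) (Q t0 f) =
    t^-1 * \int[@lebesgue_measure R]_(s in `[0, t]) pairing mu (Q s (Q t0 f)).
  move=> tp bf; have bQ := mk_bm (msg_mk sg t0_ge0) bf.
  have [_ h] := @hA t tp; rewrite h; last exact/B_bP.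
  have -> // : \int[@lebesgue_measure R]_(s in `[0, t]) pairing (T s mu) (Q t0 f) =
      \int[@lebesgue_measure R]_(s in `[0, t]) pairing mu (Q s (Q t0 f)).
  apply: eq_Rintegral => s; rewrite in_setE => st.
  have s0 : 0 <= s by move: st; rewrite /= in_itv/= => /andP[].
  exact: pairing_dual.
have cA' f : @bm _ Y R f -> pairing (A t mu) f @[t --> +oo] --> pairing nu f.
  by move=> bf; apply/cA/B_bP.
have [M hM] := nrm_convergence (al := fun t => pairing (A t mu)) (p0 := pairing nu)
  sg gU t0_ge0 pLa domLa dual_orbit_cvg0 (pos_pairing mu0)
  (fun f bf => dual_orbit_continuous (mu := mu) bf) pA alE (signed_pairing nu) cA' e0.
exists M => t /hM; congr (_ <= _); apply: eq_nrm => f bf.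
by rewrite (pairing_dual nu t0_ge0 (bm1_bm bf)).
Qed.

End main.

End Interface.

Theorem theorem3p6 (R : realType) (Omega : ptopologicalType)
    (hOmega : polish R Omega) (T : R -> operator R Omega)
    (hT : markovian_semigroup T) (hTc : stochastically_continuous T)
    (hTe : B_b_ergodic T)
    (hTf : exists2 t0 : R, 0 < t0 & strong_feller (T t0)) :
  forall mu : signed_measure R Omega,
    exists nu : signed_measure R Omega, tv_cvg (fun t => T t mu) nu.
Proof.
move=> mu; have [t0 t00 hF] := hTf; have [A [hA hcv]] := hTe.
(* The abstract result is about positive measures, so the Jordan parts are treated apart, each with
   its own limit of averages. *)
pose mup : signed_measure R Omega :=
  charge_of_finite_measure (jordan_pos (hahn_pos_neg mu)).
pose mun : signed_measure R Omega :=
  charge_of_finite_measure (jordan_neg (hahn_pos_neg mu)).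
have [nup hp] := hcv mup; have [nun hn] := hcv mun.
have mup0 : nonneg_charge mup by move=> B mB; exact: measure_ge0.
have mun0 : nonneg_charge mun by move=> B mB; exact: measure_ge0.
have sg := dual_semigroup hT.
have split_mu f : @bm _ (borel Omega) R f -> pairing mu f = pairing mup f - pairing mun f.
  move: f; apply: (@eq_signed _ (borel Omega) R (pairing mu)
    (fun f => pairing mup f - pairing mun f)).
  - exact: signed_pairing.
  - exact: signedB (signed_pairing mup) (signed_pairing mun).
  move=> B mB; rewrite !pairing_indic// (jordan_decomp (hahn_pos_neg mu) mB).
  set h := hahn_pos_neg mu.
  rewrite -[cadd _ _ B]/(jordan_pos h B + (-1)%:E * jordan_neg h B)%E.
  have f1 : jordan_pos h B \is a fin_num by exact: fin_num_measure.
  have f2 : jordan_neg h B \is a fin_num by exact: fin_num_measure.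
  rewrite fineD//; last by rewrite fin_numM.
  by rewrite fineM//= mulN1r.
exists (cadd (T t0 nup) (copp (T t0 nun))); apply/cvgrPdist_le => e e0.
have e2 : 0 < e / 2 by rewrite divr_gt0.
have [M1 h1] := nonneg_convergence hOmega hT hTc t00 hF hA mup0 hp e2.
have [M2 h2] := nonneg_convergence hOmega hT hTc t00 hF hA mun0 hn e2.
exists (Num.max 0 (Num.max M1 M2)); split; first exact: num_real.
move=> t; rewrite !gt_max => /and3P[t_ge0 /ltW/h1 {}h1 /ltW/h2 {}h2].
rewrite sub0r normrN.
have /andP[tv0 tv1] := tv_norm_le (cadd (T t mu) (copp (cadd (T t0 nup) (copp (T t0 nun))))).
rewrite ger0_norm//; apply: (le_trans tv1); apply: nrm_le => f bf.
have bf' := bm1_bm bf; have bQ := bmQ sg (ltW t_ge0) bf'.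
rewrite !pairingB// (pairing_dual hT mu (ltW t_ge0) bf') split_mu//.
have sD (m n : signed_measure R Omega) : @signed _ (borel Omega) R
    (fun f => pairing m (dual_op (T t) f) - pairing (T t0 n) f).
  by apply: signedB; [exact: (signedQ sg (ltW t_ge0) (signed_pairing m))|exact: signed_pairing].
apply: dist_sub_le.
  exact: le_trans (nrm_norm (sD mup nup) bf) h1.
exact: le_trans (nrm_norm (sD mun nun) bf) h2.
Qed.
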